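(* Let $\widetilde{\mathcal{A}}_{\mathrm{mg}}=I\otimes\widetilde{A}_{\mathrm{mg}}$, $\mathcal{B}=I\otimes B$ and $\widetilde{\mathcal{S}}_p=I\otimes D_p$, with all matrices and constants as defined in the context. Then $$\delta\,\theta^2\gamma^2\;\le\;\frac{\boldsymbol q^{\mathrm T}\,\mathcal{B}\,\widetilde{\mathcal{A}}_{\mathrm{mg}}^{-1}\,\mathcal{B}^{\mathrm T}\,\boldsymbol q}{\boldsymbol q^{\mathrm T}\,\widetilde{\mathcal{S}}_p\,\boldsymbol q}\;\le\;\Delta\,\Theta^2\qquad\text{for all }\boldsymbol q\in\mathbb{R}^{QN_p}\setminus\{\boldsymbol 0,\boldsymbol 1\},$$ where writing $\setminus\{\boldsymbol 0,\boldsymbol 1\}$ means that all constant vectors $\boldsymbol q$ are excluded.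
   Context: Setting. $D\subset\mathbb{R}^2$ is a bounded domain with sufficiently regular boundary, equipped with a regular triangulation of mesh size $h$. The problem is a stochastic Galerkin finite element discretization of enclosed Stokes flow with random viscosity. $I$ is the $Q\times Q$ identity matrix, where $Q=\binom{M+k}{k}$ is the dimension of the space of $M$-variate polynomials of total degree at most $k$, and $\otimes$ denotes the Kronecker product. Finite element matrices (Taylor-Hood $P_2/P_1$). Let $\{\phi_i\}_{i=1}^{N_u}$ be the basis of the space $\boldsymbol V_0^h$ of vector-valued continuous piecewise quadratic functions on the triangulation vanishing on $\partial D$, and $\{\varphi_i\}_{i=1}^{N_p}$ the nodal basis of continuous piecewise linear functions. Let $W_0^h$ be the space of continuous piecewise linear functions $q$ with $\int_D q\,dx=0$. Define $(A)_{ij}=\int_D\nabla\phi_i\cdot\nabla\phi_j\,dx$, $(B)_{ij}=-\int_D\varphi_i\,\nabla\cdot\phi_j\,dx$ ($B\in\mathbb{R}^{N_p\times N_u}$), $(M_p)_{ij}=\int_D\varphi_i\varphi_j\,dx$ (the pressure mass matrix), and $D_p=\operatorname{diag}(M_p)$, the diagonal part of $M_p$. Multigrid preconditioner. $\widetilde{A}_{\mathrm{mg}}\in\mathbb{R}^{N_u\times N_u}$ (one multigrid V-cycle) is symmetric and spectrally equivalent to $A$: there are constants $\delta,\Delta>0$, independent of $h$, with $\delta\le \frac{\boldsymbol v^{\mathrm T}A\boldsymbol v}{\boldsymbol v^{\mathrm T}\widetilde{A}_{\mathrm{mg}}\boldsymbol v}\le\Delta$ for all $\boldsymbol v\in\mathbb{R}^{N_u}\setminus\{\boldsymbol0\}$.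 Constants. $\gamma>0$ is the inf-sup constant of the mixed finite element approximation: $\gamma=\inf_{0\ne q\in W_0^h}\sup_{0\ne v\in\boldsymbol V_0^h}\frac{|\int_D q\,\nabla\cdot v\,dx|}{\|\nabla v\|_{L^2(D)}\|q\|_{L^2(D)}}$ (the elements are inf-sup stable). $\theta,\Theta>0$ are constants with $\theta^2\le\frac{\boldsymbol q^{\mathrm T}M_p\boldsymbol q}{\boldsymbol q^{\mathrm T}D_p\boldsymbol q}\le\Theta^2$ for all $\boldsymbol q\in\mathbb{R}^{N_p}\setminus\{\boldsymbol 0\}$ (for these elements $\theta^2=\tfrac12$, $\Theta^2=2$).
   Formalization: The lower bound is false for general non-constant q (e.g. 1+εe₁, since Bᵀ1=0); it is proved for nonzero q whose Q blocks each represent a zero-mean pressure in W_0^h. The upper bound is proved for all nonzero q. *)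

(* Defs.v *)
From HB Require Import structures.
From mathcomp Require Import all_boot all_order all_algebra.
From mathcomp Require Import all_classical all_reals all_analysis.
From mathcomp Require Import mxtens.

Set Implicit Arguments.
Unset Strict Implicit.
Unset Printing Implicit Defensive.
Import Order.TTheory GRing.Theory Num.Theory.
Import numFieldNormedType.Exports.

Local Open Scope classical_set_scope.
Local Open Scope ring_scope.

Section FiniteElements.
Context {R : realType}.
Local Notation plane := (R * R)%type.

Definition area := (@lebesgue_measure R \x @lebesgue_measure R)%E.

(* The last condition rules out cracks and boundaries of positive area.  No
   further regularity of the (polygonal) boundary is assumed. *)
Definition bounded_domain (D : set plane) : Prop :=
  [/\ open D, connected D, D !=set0, bounded_set D & interior (closure D) = D].

Definition simplex (n : nat) (x : 'I_n -> plane) (K : {set 'I_n}) : set plane :=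
  [set y | exists a : 'I_n -> R,
    [/\ forall i, 0 <= a i, forall i, i \notin K -> a i = 0,
        \sum_i a i = 1 & y = \sum_i a i *: x i]].

(* [x] lists the vertices of the mesh and [C] the triangles, each given by its
   set of three vertices; two triangles meet in the simplex, possibly empty,
   spanned by their common vertices. *)
Record triangulation (D : set plane) (n : nat) (x : 'I_n -> plane)
    (C : {set {set 'I_n}}) : Prop := Triangulation {
  tri_vertex_inj : injective x;
  tri_vertex_used : forall i, exists2 K, K \in C & i \in K;
  tri_card : forall K, K \in C -> #|K| = 3%N;
  tri_nondegenerate : forall K, K \in C -> interior (simplex x K) !=set0;
  tri_conforming : forall K L, K \in C -> L \in C ->
    simplex x K `&` simplex x L = simplex x (K :&: L);
  tri_cover : closure D = \bigcup_(K in [set K | K \in C]) simplex x K }.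

Definition poly2 (k : nat) (c : nat -> nat -> R) (y : plane) : R :=
  \sum_(i < k.+1) \sum_(j < k.+1 | (i + j <= k)%N) c i j * y.1 ^+ i * y.2 ^+ j.

Section Mesh.
Variables (D : set plane) (n : nat) (x : 'I_n -> plane) (C : {set {set 'I_n}}).

(* A function on [closure D] is represented by its extension by zero, so that
   equality of functions is equality on [closure D]. *)
Definition cont_pw_poly (k : nat) (f : plane -> R) : Prop :=
  [/\ {within closure D, continuous f},
      forall y, ~ closure D y -> f y = 0
    & forall K, K \in C ->
        exists c, forall y, simplex x K y -> f y = poly2 k c y].

Definition V0h (v : plane -> plane) : Prop :=
  [/\ cont_pw_poly 2 (fst \o v), cont_pw_poly 2 (snd \o v)
    & forall y, (closure D `\` D) y -> v y = 0].

Definition Wh (q : plane -> R) : Prop := cont_pw_poly 1 q.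

Definition W0h (q : plane -> R) : Prop :=
  Wh q /\ \int[area]_(y in D) q y = 0.

Definition mesh_interior : set plane :=
  \bigcup_(K in [set K | K \in C]) interior (simplex x K).

(* The gradient of a piecewise polynomial is defined almost everywhere; it is
   set to zero on the edges of the mesh. *)
Definition partial (e : plane) (f : plane -> R) : plane -> R :=
  (fun y => 'D_e f y) \_ mesh_interior.
Definition dx := partial (1, 0).
Definition dy := partial (0, 1).

Definition grad_dot (v w : plane -> plane) (y : plane) : R :=
  dx (fst \o v) y * dx (fst \o w) y + dy (fst \o v) y * dy (fst \o w) y +
  dx (snd \o v) y * dx (snd \o w) y + dy (snd \o v) y * dy (snd \o w) y.

Definition divergence (v : plane -> plane) (y : plane) : R :=
  dx (fst \o v) y + dy (snd \o v) y.

Definition L2norm (q : plane -> R) : R :=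
  Num.sqrt (\int[area]_(y in D) (q y ^+ 2)).

Definition grad_L2norm (v : plane -> plane) : R :=
  Num.sqrt (\int[area]_(y in D) grad_dot v v y).

(* extended-real valued, so that the infimum and suprema are genuine *)
Definition inf_sup_constant : \bar R :=
  ereal_inf [set s | exists q, [/\ W0h q, q <> (fun=> 0)
    & s = ereal_sup [set t | exists v, [/\ V0h v, v <> (fun=> 0)
        & t = (`| \int[area]_(y in D) (q y * divergence v y) | /
               (grad_L2norm v * L2norm q))%:E]]]].

Definition velocity_basis (m : nat) (phi : 'I_m -> plane -> plane) : Prop :=
  (forall i, V0h (phi i)) /\
  forall v, V0h v ->
    exists! c : {ffun 'I_m -> R}, v = (fun y => \sum_i c i *: phi i y).

Definition nodal_basis (psi : 'I_n -> plane -> R) : Prop :=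
  (forall i, Wh (psi i)) /\ forall i j, psi i (x j) = (i == j)%:R.

Definition stiffness (m : nat) (phi : 'I_m -> plane -> plane) : 'M[R]_m :=
  \matrix_(i, j) \int[area]_(y in D) grad_dot (phi i) (phi j) y.

Definition div_matrix (m : nat) (phi : 'I_m -> plane -> plane)
    (psi : 'I_n -> plane -> R) : 'M[R]_(n, m) :=
  \matrix_(i, j) - \int[area]_(y in D) (psi i y * divergence (phi j) y).

Definition mass_matrix (psi : 'I_n -> plane -> R) : 'M[R]_n :=
  \matrix_(i, j) \int[area]_(y in D) (psi i y * psi j y).

(* [q], of length Q n, is the coefficient vector of an element of the tensor
   product of R^Q with W_0^h: each of its Q blocks is a zero-mean pressure.
   This is how constants are excluded from the lower bound: the divergence
   matrix annihilates constants in each block separately, and no positive lower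
   bound can hold on the set of all merely non-constant vectors. *)
Definition zero_mean_pressure (Q : nat) (psi : 'I_n -> plane -> R)
    (q : 'cV[R]_(Q * n)) : Prop :=
  forall s : 'I_Q,
    W0h (fun y => \sum_(j < n) q (mxtens_index (s, j)) 0 * psi j y).

End Mesh.
End FiniteElements.

Section LinearAlgebra.
Context {R : realType}.

Definition diag_part (n : nat) (A : 'M[R]_n) : 'M[R]_n :=
  diag_mx (\row_i A i i).

Definition quad_form (n : nat) (A : 'M[R]_n) (v : 'cV[R]_n) : R :=
  (v^T *m A *m v) 0 0.

End LinearAlgebra.

(* Main.v *)
Require Import Defs.
From HB Require Import structures.
From mathcomp Require Import all_boot all_order all_algebra.
From mathcomp Require Import all_classical all_reals all_analysis.
From mathcomp Require Import measurable_realfun mxtens ring lra.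
Import Order.TTheory GRing.Theory Num.Theory.
Import numFieldNormedType.Exports.
Local Open Scope classical_set_scope.
Local Open Scope ring_scope.

(** Tensoring with the identity makes both quadratic forms sums over the [Q]
    blocks, so it suffices to compare, for one pressure [q], the Schur form
    [q^T B S^-1 B^T q], where [S] is the multigrid matrix, with the mass form.

    Upper bound: testing with the velocity [- w / Delta], [S w = B^T q], reduces
    it to [||div v|| <= ||grad v||] for [v] in [V_0^h], that is to
    [int (d_x u)(d_y w) = int (d_y u)(d_x w)] for the components of [v].  Being
    continuous, piecewise quadratic and zero on the boundary, they extend by zero
    to Lipschitz functions on the plane.  For difference quotients the identity
    (with forward steps on one side and backward ones on the other) is just
    translation invariance of the area, and dominated convergence yields the
    derivatives, as the edges of the mesh are negligible.

    Lower bound: by Cauchy-Schwarz for [S], the square of every quotient in the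
    inf-sup constant is at most the Schur form divided by [delta] times the mass
    form. *)

(** * Translation invariance of the area *)

Section Translation.
Context {R : realType}.
Local Notation mR := (measurableTypeR R).
Local Notation mu := (@lebesgue_measure R).
Local Notation plane := (R * R)%type.

(** A measure that agrees with [mu] on half-open intervals is [mu], and a shift keeps their
    lengths. *)
Lemma lebesgue_measure_shift (c : R) (A : set mR) : measurable A ->
  mu ((fun t : mR => t + c) @^-1` A) = mu A.
Proof.
move=> mA; have mc : measurable_fun setT ((fun t => t + c) : mR -> mR).
  exact: measurable_funD.
apply/esym; rewrite -[LHS]/(mu A) -[RHS]/(pushforward mu ((fun t => t + c) : mR -> mR) A).
apply: lebesgue_measure_unique => //= _ [[a b]] _ <-.
rewrite /pushforward.
have -> : (fun t : mR => t + c) @^-1` [set` `]a, b]] = [set` `](a - c), (b - c)]].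
  by apply/seteqP; split=> t /=; rewrite !in_itv /= lerBrDr ltrBlDr.
rewrite !lebesgue_measure_itv /= !lte_fin ltrD2r; case: ifP => // _.
by rewrite -!EFinB; congr (_%:E); ring.
Qed.

Lemma measurable_shift (c : plane) :
  measurable_fun setT (fun y : mR * mR => (y + c : mR * mR)).
Proof.
apply/measurable_fun_pairP; split.
  by apply: measurable_realfun.measurable_funD => //; exact: measurable_fst.
by apply: measurable_realfun.measurable_funD => //; exact: measurable_snd.
Qed.

(** By uniqueness of the product measure only rectangles matter, and there the shift acts on each
    factor separately. *)
Lemma area_shift (c : plane) (A : set (mR * mR)) : measurable A ->
  area ((fun y : mR * mR => (y + c : mR * mR)) @^-1` A) = area A.
Proof.
move=> mA; have mc := measurable_shift c.
apply/esym; rewrite -[RHS]/(pushforward area (fun y : mR * mR => (y + c : mR * mR)) A).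
apply: product_measure_unique => // U V mU mV.
rewrite -[LHS]/(area ((fun t : mR => t + c.1) @^-1` U `*`
  (fun t : mR => t + c.2) @^-1` V)).
have mshift (d : R) (W : set mR) :
    measurable W -> measurable ((fun t : mR => t + d) @^-1` W).
  move=> mW; rewrite -[X in measurable X]setTI.
  have : measurable_fun setT ((fun t => t + d) : mR -> mR) by exact: measurable_funD.
  exact.
rewrite /area product_measure1E; [|exact: mshift|exact: mshift].
by congr (_ * _)%E; exact: lebesgue_measure_shift.
Qed.

End Translation.

(** * Bounded integrands with bounded support *)

Section Integrands.
Context {R : realType}.
Local Notation mR := (measurableTypeR R).
Local Notation mplane := (mR * mR)%type.
Local Notation plane := (R * R)%type.

(** The measurable sets of [mplane] are generated by rectangles, not by open sets; an open set is
    the countable union of the rational open boxes that it contains. *)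
Lemma open_measurable_plane (A : set plane) :
  open A -> measurable (A : set mplane).
Proof.
move=> oA; pose box (q : (rat * rat) * (rat * rat)) : set mplane :=
  [set` `]ratr q.1.1, (ratr q.1.2 : R)[] `*` [set` `]ratr q.2.1, (ratr q.2.2 : R)[].
pose F q := if `[< box q `<=` A >] then box q else set0.
have -> : A = \bigcup_q F q.
  apply/seteqP; split=> y; last first.
    by move=> [q _]; rewrite /F; case: asboolP => // sub; exact: sub.
  move=> Ay; have /nbhs_ballP[r /= r0 yrA] : nbhs y A by exact: open_nbhs_nbhs.
  have lt1 t : t - r < t by rewrite ltrBlDr ltrDl.
  have lt2 t : t < t + r by rewrite ltrDl.
  have [a1] := rat_in_itvoo (lt1 y.1); have [b1] := rat_in_itvoo (lt2 y.1).
  have [a2] := rat_in_itvoo (lt1 y.2); have [b2] := rat_in_itvoo (lt2 y.2).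
  rewrite !in_itv /= => /andP[h1 h2] /andP[h3 h4] /andP[h5 h6] /andP[h7 h8].
  exists ((a1, b1), (a2, b2)) => //; rewrite /F; case: asboolP => [_|]; last first.
    case=> z [/=]; rewrite !in_itv /= => /andP[z1 z2] /andP[z3 z4].
    by apply: yrA; split; rewrite /ball /= ltr_norml; apply/andP; split; lra.
  by split; rewrite /= in_itv /=; apply/andP; split.
apply: countable_bigcupT_measurable => [|q]; first exact: countableP.
rewrite /F; case: ifP => // _.
by apply: measurableX; exact: measurable_itv.
Qed.

Lemma closed_measurable_plane (A : set plane) :
  closed A -> measurable (A : set mplane).
Proof.
by move=> /closed_openC/open_measurable_plane/measurableC; rewrite setCK.
Qed.

Definition box (B : R) : set mplane := `[- B, B]%classic `*` `[- B, B]%classic.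

Lemma boxE (B : R) (y : plane) : box B y <-> `|y| <= B.
Proof.
rewrite /box /= !in_itv /= prod_normE ge_max !ler_norml; split.
  by move=> [-> ->].
by move=> /andP.
Qed.

Lemma measurable_box (B : R) : measurable (box B).
Proof. by apply: measurableX; exact: measurable_itv. Qed.

Lemma area_box_lty (B : R) : (area (box B) < +oo)%E.
Proof.
rewrite /area /box product_measure1E; [|exact: measurable_itv|exact: measurable_itv].
have : (lebesgue_measure ([set` `[(- B)%R, B]] : set mR) < +oo)%E.
  by rewrite lebesgue_measure_itv /=; case: ifP => // _; rewrite -EFinB ltry.
move=> h; rewrite lte_mul_pinfty//.
by rewrite ge0_fin_numE.
Qed.

(* Integrands are required to be bounded with bounded support, so that they
   form an algebra of integrable functions. *)
Record integrand (f : plane -> R) : Prop := Integrand {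
  integrand_measurable : measurable_fun [set: mplane] f;
  integrand_bounded : exists M, forall y, `|f y| <= M;
  integrand_support : exists B, forall y, B < `|y| -> f y = 0 }.

Lemma integrandP (f : plane -> R) : integrand f ->
  exists M, exists B, [/\ 0 <= M, 0 <= B, forall y, `|f y| <= M
    & forall y, B < `|y| -> f y = 0].
Proof.
move=> [_ [M fM] [B fB]]; exists M, (Num.max B 0); split=> //.
- by apply: le_trans (fM 0).
- by rewrite le_max lexx orbT.
- by move=> y; rewrite gt_max => /andP[/fB].
Qed.

Lemma integrand0 : integrand (fun=> 0).
Proof. by split=> //; exists 0 => // y; rewrite normr0. Qed.

Lemma integrandD (f g : plane -> R) :
  integrand f -> integrand g -> integrand (fun y => f y + g y).
Proof.
move=> intf intg; have [mf _ _] := intf; have [mg _ _] := intg.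
have [M [B [M0 B0 fM fB]]] := integrandP _ intf.
have [N [E [N0 E0 gN gE]]] := integrandP _ intg.
split; first exact: measurable_realfun.measurable_funD.
- by exists (M + N) => y; rewrite (le_trans (ler_normD _ _))// lerD.
- exists (Num.max B E) => y; rewrite gt_max => /andP[/fB -> /gE ->].
  by rewrite addr0.
Qed.

Lemma integrandM (f g : plane -> R) :
  integrand f -> integrand g -> integrand (fun y => f y * g y).
Proof.
move=> intf intg; have [mf _ _] := intf; have [mg _ _] := intg.
have [M [B [M0 B0 fM fB]]] := integrandP _ intf.
have [N [E [N0 E0 gN gE]]] := integrandP _ intg.
split; first exact: measurable_realfun.measurable_funM.
- by exists (M * N) => y; rewrite normrM ler_pM.
- by exists B => y /fB ->; rewrite mul0r.
Qed.

Lemma integrandZ (c : R) (f : plane -> R) :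
  integrand f -> integrand (fun y => c * f y).
Proof.
move=> intf; have [mf _ _] := intf.
have [M [B [M0 B0 fM fB]]] := integrandP _ intf.
split; first exact: measurable_realfun.measurable_funM.
- by exists (`|c| * M) => y; rewrite normrM ler_pM.
- by exists B => y /fB ->; rewrite mulr0.
Qed.

Lemma integrandB (f g : plane -> R) :
  integrand f -> integrand g -> integrand (fun y => f y - g y).
Proof.
move=> intf /(integrandZ (-1)) intg.
by have := integrandD _ _ intf intg; under eq_fun do rewrite mulN1r.
Qed.

Lemma integrand_sum (I : Type) (s : seq I) (f : I -> plane -> R) :
  (forall i, integrand (f i)) -> integrand (fun y => \sum_(i <- s) f i y).
Proof.
move=> intf; elim: s => [|i s IHs].
  by under eq_fun do rewrite big_nil; exact: integrand0.
by under eq_fun do rewrite big_cons; exact: integrandD.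
Qed.

Lemma integrand_shift (c : plane) (f : plane -> R) :
  integrand f -> integrand (fun y => f (y + c)).
Proof.
move=> intf; have [mf _ _] := intf.
have [M [B [M0 B0 fM fB]]] := integrandP _ intf.
split; first exact: (measurableT_comp mf (measurable_shift c)).
- by exists M.
- exists (B + `|c|) => y ltB; apply: fB.
  have := ler_normB (y + c) c; rewrite addrK => h.
  by rewrite -(ltrD2r `|c|) (lt_le_trans ltB).
Qed.

(** Outside a box [f] vanishes, and on the box, of finite area, a bounded measurable function is
    integrable. *)
Lemma integrand_integrable (f : plane -> R) (A : set plane) :
  measurable (A : set mplane) -> integrand f ->
  (@area R).-integrable A (EFin \o f).
Proof.
move=> mA intf; have [mf _ _] := intf.
have [M [B [M0 B0 fM fB]]] := integrandP _ intf.
apply: (@integrableS _ _ _ _ setT) => //.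
have -> : EFin \o f = (EFin \o f) \_ (box B).
  apply/funext => y; rewrite patchE; case: ifPn => //.
  rewrite notin_setE => /boxE/negP; rewrite -ltNge => /fB /= ->.
  by [].
apply/(integrable_mkcond _ (measurable_box B)).
apply: measurable_bounded_integrable.
- exact: measurable_box.
- exact: area_box_lty.
- exact: measurable_funS mf.
- exists M; split; first exact: num_real.
  by move=> x Mx y _ /=; rewrite (le_trans (fM y))// ltW.
Qed.

(** Change of variables: the image of the area under a shift is the area. *)
Lemma Rintegral_shift (c : plane) (f : plane -> R) : integrand f ->
  \int[area]_y f (y + c) = \int[area]_y f y.
Proof.
move=> intf; congr fine.
have mc := measurable_shift c.
have mf : measurable_fun [set: mplane] (EFin \o f).
  by apply/measurable_EFinP; have [] := intf.
have intc : (@area R).-integrable ((fun y : mplane => (y + c : mplane)) @^-1` setT)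
    ((EFin \o f) \o (fun y : mplane => (y + c : mplane))).
  rewrite preimage_setT; apply: (@integrand_integrable (fun y => f (y + c))) => //.
  exact: integrand_shift.
have := integral_pushforward mc mf intc measurableT.
rewrite preimage_setT => <-.
by apply: eq_measure_integral => A mA _; exact: area_shift.
Qed.

End Integrands.

(** * Mixed derivatives of Lipschitz functions *)

Section MixedDerivatives.
Context {R : realType}.
Local Notation mR := (measurableTypeR R).
Local Notation mplane := (mR * mR)%type.
Local Notation plane := (R * R)%type.
Implicit Types (u w : plane -> R) (c d e : plane).

(** A discrete integration by parts. After expansion, shifts by [c + d], [c] and [d] carry the terms
    of one side to those of the other, the two terms with one shifted factor changing places. *)
Lemma Rintegral_mixed_difference u w c d : integrand u -> integrand w ->
  \int[area]_y ((u (y + c) - u y) * (w (y + d) - w y)) =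
  \int[area]_y ((u (y - d) - u y) * (w (y - c) - w y)).
Proof.
move=> intu intw.
pose I f : R := \int[area]_y f y.
have ID f g : integrand f -> integrand g -> I (fun y => f y + g y) = I f + I g.
  by move=> intf intg; apply: RintegralD => //; exact: integrand_integrable.
have IB f g : integrand f -> integrand g -> I (fun y => f y - g y) = I f - I g.
  by move=> intf intg; apply: RintegralB => //; exact: integrand_integrable.
have expand (c1 d1 : plane) :
    I (fun y => (u (y + c1) - u y) * (w (y + d1) - w y)) =
    I (fun y => u (y + c1) * w (y + d1)) - I (fun y => u (y + c1) * w y)
    - I (fun y => u y * w (y + d1)) + I (fun y => u y * w y).
  have i1 := integrandM _ _ (integrand_shift c1 _ intu) (integrand_shift d1 _ intw).
  have i2 := integrandM _ _ (integrand_shift c1 _ intu) intw.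
  have i3 := integrandM _ _ intu (integrand_shift d1 _ intw).
  have i4 := integrandM _ _ intu intw.
  rewrite -IB// -IB//; last exact: integrandB.
  rewrite -ID//; last by apply: integrandB => //; exact: integrandB.
  by congr I; apply/funext => y; ring.
rewrite -!/(I _) !expand; congr (_ + _).
have -> : I (fun y => u (y + c) * w (y + d)) = I (fun y => u (y - d) * w (y - c)).
  rewrite -[RHS](@Rintegral_shift _ (c + d) (fun y => u (y - d) * w (y - c))).
    by congr I; apply/funext => y; rewrite addrA addrK addrAC addrK.
  by apply: integrandM; exact: integrand_shift.
have -> : I (fun y => u (y + c) * w y) = I (fun y => u y * w (y - c)).
  rewrite -[RHS](@Rintegral_shift _ c (fun y => u y * w (y - c))).
    by congr I; apply/funext => y; rewrite addrK.
  by apply: integrandM => //; exact: integrand_shift.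
have -> : I (fun y => u y * w (y + d)) = I (fun y => u (y - d) * w y).
  rewrite -[RHS](@Rintegral_shift _ d (fun y => u (y - d) * w y)).
    by congr I; apply/funext => y; rewrite addrK.
  by apply: integrandM => //; exact: integrand_shift.
by rewrite addrAC.
Qed.

Definition lipschitz_along e u :=
  exists L : R, forall y h, `|u (y + h *: e) - u y| <= L * `|h|.

(** The quotient has the shape used by [derivable], but the limit is a parameter, so that [partial],
    with its default value, can serve as the derivative. *)
Definition has_derivative_along e u (y : plane) (l : R) :=
  h^-1 *: (u (h *: e + y) - u y) @[h --> 0^'] --> l.

Definition diff_quotient (t : R) e u (y : plane) : R := t^-1 * (u (y + t *: e) - u y).

Lemma integrand_quotient (t : R) e u : integrand u -> integrand (diff_quotient t e u).
Proof.
move=> intu; apply: integrandZ; apply: integrandB => //.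
exact: integrand_shift.
Qed.

(** Dominated convergence needs a sequence of steps; being nonzero, they approach 0 within its
    punctured neighbourhoods. *)
Lemma cvg_quotient e u y (l : R) (t : nat -> R) :
  has_derivative_along e u y l -> (forall n, t n != 0) ->
  t n @[n --> \oo] --> 0 -> diff_quotient (t n) e u y @[n --> \oo] --> l.
Proof.
move=> du t0 t_cvg; have t_dnbhs : t n @[n --> \oo] --> 0^'.
  move=> A A0; have tA : \forall n \near \oo, t n != 0 -> A (t n) by exact: (t_cvg _ A0).
  by rewrite /nbhs /=; apply: filterS tA => n; apply.
have -> : (fun n => diff_quotient (t n) e u y) =
    (fun h => h^-1 *: (u (h *: e + y) - u y)) \o t.
  by apply/funext => n /=; rewrite /diff_quotient [y + _]addrC.
exact: cvg_comp t_dnbhs du.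
Qed.

Lemma quotient_le e u (L t : R) y :
  (forall y h, `|u (y + h *: e) - u y| <= L * `|h|) -> t != 0 ->
  `|diff_quotient t e u y| <= L.
Proof.
move=> uL t0; rewrite /diff_quotient normrM normfV.
by rewrite mulrC ler_pdivrMr ?normr_gt0.
Qed.

#[global] Instance area_ae_filter : Filter (almost_everywhere (@area R)).
Proof. rewrite /area; exact: _. Qed.

(** Dominated convergence, with the product of the two Lipschitz constants as bound, cut off to a
    box outside which all the quotients of [u] vanish. *)
Lemma cvg_Rintegral_quotient u w u' w' e f (t : nat -> R) :
  integrand u -> integrand w -> integrand u' -> integrand w' ->
  lipschitz_along e u -> lipschitz_along f w ->
  {ae area, forall y, has_derivative_along e u y (u' y)} ->
  {ae area, forall y, has_derivative_along f w y (w' y)} ->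
  (forall n, t n != 0) -> (forall n, `|t n| <= 1) -> t n @[n --> \oo] --> 0 ->
  \int[area]_y (diff_quotient (t n) e u y * diff_quotient (t n) f w y) @[n --> \oo] -->
  \int[area]_y (u' y * w' y).
Proof.
move=> intu intw intu' intw' [L uL] [K wK] du dw t0 t1 t_cvg.
have [M [B [M0 B0 uM uB]]] := integrandP _ intu.
(* Steps are at most 1 in absolute value: for [y] beyond radius [E], both [y] and [y + t n *: e] are
   beyond radius [B], where [u] vanishes. *)
pose E := B + `|e|.
pose g := fun y : plane => (L * K) * \1_(box E) y.
have intg : integrand g.
  apply: integrandZ; split; first exact: measurable_indic (measurable_box E).
  - by exists 1 => y; rewrite indicE; case: (_ \in _); rewrite /= ?normr1 ?normr0.
  - exists E => y ltE; rewrite indicE memNset// => /boxE.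
    by rewrite leNgt ltE.
have int_quotient n :
    integrand (fun y => diff_quotient (t n) e u y * diff_quotient (t n) f w y).
  by apply: integrandM; exact: integrand_quotient.
have quotient_le_g n y : `|diff_quotient (t n) e u y * diff_quotient (t n) f w y| <= g y.
  rewrite normrM /g indicE; case: (boolP (y \in box E)) => [_|]; last first.
    rewrite notin_setE => /boxE/negP; rewrite -ltNge => ltE.
    rewrite [diff_quotient (t n) e u y]/diff_quotient !uB ?subrr ?mulr0 ?normr0 ?mul0r//.
      by rewrite (le_lt_trans _ ltE)// lerDl.
    have := ler_normB (y + t n *: e) (t n *: e); rewrite addrK => h.
    have := lt_le_trans ltE h; rewrite /E => h2.
    have : `|t n *: e| <= `|e|.
      by rewrite normrZ ler_piMl.
    by move=> h3; lra.
  by rewrite mulr1 ler_pM ?(quotient_le _ _ _ _ _ uL) ?(quotient_le _ _ _ _ _ wK).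
have mfun h : integrand h -> measurable_fun [set: mplane] (EFin \o h).
  by move=> [mh _ _]; exact/measurable_EFinP.
have [||_ _ cvg_int] := @dominated_convergence _ _ R area setT measurableT
  (fun n y => (diff_quotient (t n) e u y * diff_quotient (t n) f w y)%:E)
  (fun y => (u' y * w' y)%:E) (fun y => (g y)%:E) (fun n => mfun _ (int_quotient n))
  (mfun _ (integrandM _ _ intu' intw')) _
  (integrand_integrable _ _ measurableT intg) _.
- apply: filterS2 du dw => y du dw _.
  apply: cvg_EFin; first exact: nearW.
  exact: cvgM (cvg_quotient _ _ _ _ _ du t0 t_cvg) (cvg_quotient _ _ _ _ _ dw t0 t_cvg).
- by apply: aeW => y n _; rewrite /= lee_fin.
rewrite /Rintegral; apply: fine_cvg; rewrite fineK//.
apply: integrable_fin_num => //.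
exact: (integrand_integrable _ _ measurableT (integrandM _ _ intu' intw')).
Qed.

(** The two integrals are limits of sequences that coincide term by term, by the identity for mixed
    differences. *)
Lemma mixed_derivatives_swap u w ux uy wx wy :
  let e1 : plane := (1, 0) in let e2 : plane := (0, 1) in
  integrand u -> integrand w -> integrand ux -> integrand uy ->
  integrand wx -> integrand wy ->
  lipschitz_along e1 u -> lipschitz_along e2 u ->
  lipschitz_along e1 w -> lipschitz_along e2 w ->
  {ae area, forall y, has_derivative_along e1 u y (ux y)} ->
  {ae area, forall y, has_derivative_along e2 u y (uy y)} ->
  {ae area, forall y, has_derivative_along e1 w y (wx y)} ->
  {ae area, forall y, has_derivative_along e2 w y (wy y)} ->
  \int[area]_y (ux y * wy y) = \int[area]_y (uy y * wx y).
Proof.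
move=> e1 e2 intu intw intux intuy intwx intwy u1 u2 w1 w2 dux duy dwx dwy.
pose t (n : nat) : R := n.+1%:R^-1.
have t0 n : t n != 0 by rewrite /t invr_eq0 pnatr_eq0.
have t_le1 n : `|t n| <= 1 by rewrite /t ger0_norm ?invr_ge0// invf_le1// ler1n.
have t_cvg : t n @[n --> \oo] --> 0 by exact: cvg_harmonic.
have cvg1 := cvg_Rintegral_quotient _ _ _ _ _ _ _
  intu intw intux intwy u1 w2 dux dwy t0 t_le1 t_cvg.
have cvg2 := cvg_Rintegral_quotient _ _ _ _ _ _ (fun n => - t n)
  intu intw intuy intwx u2 w1 duy dwx.
have {}cvg2 : \int[area]_y (diff_quotient (- t n) e2 u y * diff_quotient (- t n) e1 w y)
    @[n --> \oo] --> \int[area]_y (uy y * wx y).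
  apply: cvg2 => [n|n|]; rewrite ?oppr_eq0 ?normrN//.
  by rewrite -[0]oppr0; exact: cvgN.
have E n : \int[area]_y (diff_quotient (t n) e1 u y * diff_quotient (t n) e2 w y) =
    \int[area]_y (diff_quotient (- t n) e2 u y * diff_quotient (- t n) e1 w y).
  (* Both quotients carry the same step, so the scaling factor is the same for [t n] and [- t n]. *)
  have scale (s : R) (c d : plane) :
      \int[area]_y (diff_quotient s c u y * diff_quotient s d w y) =
      s^-1 * s^-1 * \int[area]_y ((u (y + s *: c) - u y) * (w (y + s *: d) - w y)).
    rewrite -RintegralZl//; last first.
      apply: (integrand_integrable _ _ measurableT).
      by apply: integrandM; apply: integrandB => //; exact: integrand_shift.
    by apply: eq_Rintegral => y _; rewrite /diff_quotient; ring.
  rewrite !scale Rintegral_mixed_difference// !scaleNr invrN mulrNN.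
  by [].
move: cvg1; rewrite (funext E) => cvg1.
exact: (cvg_unique _ cvg1 cvg2).
Qed.
End MixedDerivatives.

(** * Simplices and their edges *)

Section Geometry.
Context {R : realType}.
Local Notation mR := (measurableTypeR R).
Local Notation mplane := (mR * mR)%type.
Local Notation plane := (R * R)%type.
Variables (n : nat) (x : 'I_n -> plane).
Implicit Types (K L : {set 'I_n}).

(** Barycentric coordinates range over a compact set of row vectors, and the simplex is its
    continuous image. *)
Lemma compact_simplex K : compact (simplex x K).
Proof.
(* Coordinates outside [K] are confined to 0; the condition on the sum, being closed, is imposed
   afterwards. *)
pose A : set 'rV[R]_n :=
  [set v | forall i, (if i \in K then `[0, 1]%classic else [set (0 : R)]) (v ord0 i)].
have cA : compact A.
  apply: (@rV_compact R n (fun i => if i \in K then `[0, 1]%classic else [set 0])) => i.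
  case: ifP => _; first exact: segment_compact.
  exact: compact_set1.
have csum (V : normedModType R) (F : 'I_n -> 'rV[R]_n -> V) :
    (forall i, continuous (F i)) -> continuous (fun v => \sum_i F i v).
  move=> cF; have -> : (fun v => \sum_i F i v) = \sum_i F i.
    by apply/funext => v; rewrite fct_sumE.
  elim/big_rec: _ => [|i g _ cg] v; first exact: (@cst_continuous _ _ (0 : V)).
  exact: cvgD (cF i v) (cg v).
have -> : simplex x K = (fun v : 'rV[R]_n => \sum_i v ord0 i *: x i) @`
    (A `&` (fun v => \sum_i v ord0 i) @^-1` [set 1]).
  apply/seteqP; split=> y /=.
    move=> [a [a_ge0 aK a1 ->]]; exists (\row_i a i); last first.
      by apply: eq_bigr => i _; rewrite mxE.
    split; last by rewrite -[RHS]a1; apply: eq_bigr => i _; rewrite mxE.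
    move=> i; rewrite mxE; case: ifPn => [_|/aK//].
    rewrite /= in_itv /= a_ge0 /= -a1 (bigD1 i)//= lerDl.
    by rewrite sumr_ge0.
  move=> [v [Av v1] <-]; exists (fun i => v ord0 i); split=> // i.
    by have := Av i; case: ifP => _ /=; [rewrite in_itv /= => /andP[]|move=> ->].
  by move=> /negbTE iK; have := Av i; rewrite iK.
apply: continuous_compact.
  apply: continuous_subspaceT; apply: csum => i v.
  by apply: cvgZl; [exact: nbhs_filter|exact: coord_continuous].
apply: compact_closedI => //; apply: closed_comp; last exact: closed_eq.
move=> v _; apply: csum => i w; exact: coord_continuous.
Qed.

Lemma closed_simplex K : closed (simplex x K).
Proof. by apply: compact_closed; [exact: norm_hausdorff|exact: compact_simplex]. Qed.

Lemma norm_simplex K y : simplex x K y -> `|y| <= \sum_i `|x i|.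
Proof.
move=> [a [a_ge0 aK a1 ->]]; apply: (le_trans (ler_norm_sum _ _ _)).
apply: ler_sum => i _; rewrite normrZ ler_piMl// ger0_norm//.
by rewrite -a1 (bigD1 i)//= lerDl sumr_ge0.
Qed.

(* Let [z] be an interior point: a small multiple of its barycentric coordinates
   can be subtracted from positive coordinates of [y], and the removed mass can
   then be placed at any point of a neighbourhood of [z]. *)
Lemma simplex_face K y : interior (simplex x K) !=set0 -> simplex x K y ->
  ~ interior (simplex x K) y -> exists2 i, i \in K & simplex x (K :\ i) y.
Proof.
move=> [z Kz] [a [a_ge0 aK a1 ya]] Ky; apply: contrapT => noface.
have a_gt0 i : i \in K -> 0 < a i.
  move=> iK; rewrite lt_neqAle a_ge0 andbT; apply/eqP => a0; apply: noface.
  exists i => //; exists a; split=> // j; rewrite in_setD1 negb_and negbK.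
  by move=> /orP[/eqP ->//|]; exact: aK.
have [b [b_ge0 bK b1 zb]] : simplex x K z by exact: interior_subset Kz.
have /nbhs_ballP[r /= r0 zr] : nbhs z (simplex x K) by exact: Kz.
(* Since [b i <= 1], subtracting [eps * b i] from [a i] leaves a nonnegative coordinate. *)
pose eps := \big[Num.min/1]_(i in K) a i.
have eps0 : 0 < eps.
  by rewrite /eps; elim/big_rec: _ => // i t iK t0; rewrite lt_min a_gt0.
have b_le1 i : b i <= 1 by rewrite -b1 (bigD1 i)//= lerDl sumr_ge0.
have epsa i : eps * b i <= a i.
  have [iK|iK] := boolP (i \in K); last by rewrite bK// mulr0.
  apply: (@le_trans _ _ eps); first by rewrite ler_piMr// ltW.
  by rewrite /eps (bigD1 i)//= ge_min lexx.
apply: Ky; apply/nbhs_ballP; exists (eps * r) => /=; first exact: mulr_gt0.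
move=> w; rewrite prod_norm_ball /ball_ /= => yw.
(* [w] is [eps] times this point plus [y - eps *: z]; the radius [eps * r] makes the point fall in
   the ball around [z]. *)
have : simplex x K (z + eps^-1 *: (w - y)).
  apply: zr; rewrite prod_norm_ball /ball_ /= opprD addNKr normrN normrZ.
  rewrite ger0_norm ?invr_ge0 ?ltW// mulrC ltr_pdivrMr// distrC.
  by rewrite mulrC.
move=> [c [c_ge0 cK c1 wc]]; exists (fun i => eps * c i + (a i - eps * b i)); split.
- by move=> i; rewrite addr_ge0// ?mulr_ge0 ?subr_ge0// ltW.
- by move=> i iK; rewrite cK// bK// aK// !mulr0 subrr addr0.
- by rewrite big_split /= sumrB -!mulr_sumr a1 b1 c1 mulr1; ring.
- rewrite (eq_bigr (fun i => eps *: (c i *: x i) + (a i *: x i - eps *: (b i *: x i)))).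
    rewrite big_split /= sumrB -!scaler_sumr -ya -zb -wc scalerDr scalerA.
    by rewrite mulfV ?gt_eqF// scale1r [_ *: z + _]addrC addrACA subrr addr0 subrK.
  by move=> i _; rewrite scalerDl scalerBl !scalerA.
Qed.

(** For [q = 0] the line is the product of a point and an axis; otherwise each vertical section is a
    single point, and the product measure integrates the measures of the sections. *)
Lemma area_line (p q c : R) : (p, q) <> (0, 0) ->
  (@area R).-negligible [set y | p * y.1 + q * y.2 = c].
Proof.
move=> pq0; have mline : measurable ([set y | p * y.1 + q * y.2 = c] : set mplane).
  have mf : measurable_fun [set: mplane]
      (fun y : mplane => p * (y.1 : R) + q * (y.2 : R)).
    apply: measurable_realfun.measurable_funD; exact: measurable_realfun.measurable_funM.
  by have := mf measurableT [set c] (measurable_set1 _); rewrite setTI.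
apply/(negligibleP _ mline).
have [q0|q0] := eqVneq q 0.
  have p0 : p != 0 by apply: contra_notN pq0 => /eqP ->; rewrite q0.
  have -> : [set y : plane | p * y.1 + q * y.2 = c] = [set c / p] `*` setT.
    apply/seteqP; split=> [[s t]|[s t]] /=; rewrite q0 mul0r addr0.
      by move=> <-; split=> //; rewrite mulrC mulKf.
    by move=> [-> _]; rewrite mulrC divfK.
  have mc : measurable ([set c / p] : set mR) by exact: measurable_set1.
  have mT : measurable ([set: mR]) by exact: measurableT.
  apply: etrans (product_measure1E _ _ mc mT) _.
  by rewrite [X in (X * _)%E](@lebesgue_measure_set1 R (c / p)) mul0e.
apply: integral0_eq => s _ /=.
have -> : xsection [set y : plane | p * y.1 + q * y.2 = c] s = [set (c - p * s) / q].
  apply/seteqP; split=> t; rewrite /xsection /= inE /=.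
    by move=> <-; rewrite addrAC subrr add0r mulrC mulKf.
  by move=> ->; rewrite [q * _]mulrC divfK// addrC subrK.
exact: lebesgue_measure_set1.
Qed.

(** The segment lies on the line through its two endpoints, whose normal [(- d.2, d.1)] is nonzero
    because they differ. *)
Lemma negligible_edge K : injective x -> #|K| = 2%N ->
  (@area R).-negligible (simplex x K).
Proof.
move=> x_inj /eqP/cards2P[i [j [ij ->]]].
pose d := x j - x i.
apply: (@negligibleS _ _ _ (@area R)
  [set y | - d.2 * y.1 + d.1 * y.2 = - d.2 * (x i).1 + d.1 * (x i).2]).
  move=> y [a [a_ge0 aK a1 ->]].
  have a_ij : a i + a j = 1.
    rewrite -a1 (bigD1 i)//= (bigD1 j) 1?eq_sym//= big1 ?addr0// => k /andP[ki kj].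
    by apply: aK; rewrite !inE (negbTE ki) (negbTE kj).
  have -> : \sum_k a k *: x k = a i *: x i + a j *: x j.
    rewrite (bigD1 i)//= (bigD1 j) 1?eq_sym//= big1 ?addr0// => k /andP[ki kj].
    by rewrite aK ?scale0r// !inE (negbTE ki) (negbTE kj).
  rewrite /d /=.
  have -> : a i = 1 - a j by rewrite -a_ij addrK.
  by rewrite /GRing.scale /=; ring.
apply: area_line => -[/eqP]; rewrite oppr_eq0 => /eqP d2 d1.
have : d = 0 by rewrite [d]surjective_pairing; congr (_, _).
by move=> /eqP; rewrite subr_eq0 => /eqP/x_inj ji; rewrite ji eqxx in ij.
Qed.

End Geometry.

(** * Lipschitz bounds for piecewise functions *)

Section PiecewiseLipschitz.
Context {R : realType}.
Local Notation mR := (measurableTypeR R).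
Local Notation mplane := (mR * mR)%type.
Local Notation plane := (R * R)%type.

(** Induction on the number of pieces. A piece containing [a] bounds the increment up to its last
    point [c] in the interval; if [c < b], that piece is discarded, as the others cover all of
    [[c, b]]. *)
Let lipschitz_cover_itv (I : finType) (F : I -> set R) (f : R -> R) (L : R) m :
  (forall i, closed (F i)) ->
  (forall i s t, F i s -> F i t -> `|f t - f s| <= L * `|t - s|) ->
  forall (J : {set I}) (a b : R), (#|J| <= m)%N -> a <= b ->
  (forall t, a <= t <= b -> exists2 i, i \in J & F i t) ->
  `|f b - f a| <= L * (b - a).
Proof.
move=> Fcl Flip; elim: m => [|m IHm] J a b Jm ab cover.
  have [|i] := cover a; first by rewrite lexx ab.
  by move: Jm; rewrite leqn0 cards_eq0 => /eqP ->; rewrite inE.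
have [|i iJ Fia] := cover a; first by rewrite lexx ab.
pose S := F i `&` `[a, b].
have aS : S a by split=> //; rewrite /= in_itv /= lexx.
have bS : ubound S b by move=> t [_ /=]; rewrite in_itv /= => /andP[].
have Scl : closed S by apply: closedI => //; exact: interval_closed.
have /Scl [Fic] : closure S (sup S) by apply: closure_sup; [exists a|exists b].
rewrite /= in_itv /=; set c := sup S in Fic * => /andP[ac cb].
have c_ub t : c < t -> t <= b -> ~ F i t.
  move=> ct tb Fit; have at_ : a <= t by rewrite (le_trans ac)// ltW.
  move: ct; apply/negP; rewrite -leNgt.
  apply: sup_upper_bound; first by split; [exists a|exists b].
  by split=> //=; rewrite in_itv /= tb at_.
clearbody c.
have fac : `|f c - f a| <= L * (c - a).
  by have := Flip i _ _ Fia Fic; rewrite [`|c - a|]ger0_norm ?subr_ge0.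
have [cb'|bc] := ltP c b; last first.
  by rewrite (_ : b = c)//; apply/le_anti; rewrite bc cb.
have fcb : `|f b - f c| <= L * (b - c).
  apply: (IHm (J :\ i)) => //.
    by move: Jm; rewrite (cardsD1 i) iJ.
  move=> t /andP[]; rewrite le_eqVlt => /predU1P[<-{t} _|ct tb]; last first.
    have [|j jJ Fjt] := cover t; first by rewrite tb (le_trans ac)// ltW.
    exists j => //; rewrite in_setD1 jJ andbT; apply: contra_not_neq (c_ub _ ct tb).
    by move=> <-.
  (* If no other piece contained [c], closedness would keep them all away from a neighbourhood of
     [c]; yet a point [s] just right of [c] is covered, and not by [F i]. *)
  apply: contrapT => nocover.
  have : \forall t \near c, forall j, j \in J :\ i -> ~ F j t.
    apply: (@filter_forall _ _ (fun j t => j \in J :\ i -> ~ F j t) (nbhs c) _) => j.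
    apply: (@filter_imply _ _ (~` F j) (nbhs c) _) => jJ.
    apply: open_nbhs_nbhs; split; first exact: closed_openC.
    by move=> Fjc; apply: nocover; exists j.
  move=> /nbhs_ballP[r /= r0 ball_r].
  pose s := Num.min b (c + r / 2).
  have cs : c < s by rewrite lt_min cb' ltrDl divr_gt0.
  have sb : s <= b by rewrite ge_min lexx.
  have s_r : s <= c + r / 2 by rewrite ge_min lexx orbT.
  have [|j jJ Fjs] := cover s; first by rewrite sb (le_trans ac)// ltW.
  apply: (ball_r s _ j _ Fjs).
    by rewrite /ball /= ler0_norm ?subr_le0 ?ltW// opprB; lra.
  rewrite in_setD1 jJ andbT; apply/eqP => ji; apply: (c_ub _ cs sb).
  by rewrite -ji.
apply: (le_trans (ler_distD (f c) _ _)).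
rewrite [b - a](_ : _ = (b - c) + (c - a)); last ring.
by rewrite mulrDr lerD.
Qed.

(* Only closedness of the pieces is used: consecutive pieces of an interval
   then meet, so the Lipschitz bounds chain. *)
Lemma lipschitz_closed_cover (I : finType) (F : I -> set R) (f : R -> R) (L : R) :
  (forall i, closed (F i)) -> (forall t, exists i, F i t) ->
  (forall i s t, F i s -> F i t -> `|f t - f s| <= L * `|t - s|) ->
  forall s t, `|f t - f s| <= L * `|t - s|.
Proof.
move=> Fcl cover Flip s t; wlog st : s t / s <= t.
  by move=> ih; have [/ih//|/ltW/ih] := leP s t; rewrite distrC [`|s - t|]distrC.
rewrite [`|t - s|]ger0_norm ?subr_ge0//.
apply: (lipschitz_cover_itv _ _ _ _ #|I| Fcl Flip [set: I]%SET) => //.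
  by rewrite cardsT.
by move=> r _; have [i Fir] := cover r; exists i; rewrite ?inE.
Qed.

(** The Lipschitz constant of a product involves bounds on its factors, hence the restriction to a
    ball and the constant that serves both purposes. *)
Definition bounded_lipschitz (B : R) (f : plane -> R) := exists M,
  [/\ 0 <= M, forall y, `|y| <= B -> `|f y| <= M
    & forall y z, `|y| <= B -> `|z| <= B -> `|f z - f y| <= M * `|z - y|].

Lemma bounded_lipschitz_cst B c : bounded_lipschitz B (fun=> c).
Proof.
exists `|c|; split=> // y z _ _.
by rewrite subrr normr0 mulr_ge0.
Qed.

Lemma bounded_lipschitzD B f g : bounded_lipschitz B f ->
  bounded_lipschitz B g -> bounded_lipschitz B (fun y => f y + g y).
Proof.
move=> [M [M0 fM fL]] [N [N0 gN gL]]; exists (M + N); split=> [|y yB|y z yB zB].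
- exact: addr_ge0.
- by rewrite (le_trans (ler_normD _ _))// lerD ?fM ?gN.
- rewrite opprD addrACA (le_trans (ler_normD _ _))// mulrDl.
  by rewrite lerD ?fL ?gL.
Qed.

Lemma bounded_lipschitzM B f g : bounded_lipschitz B f ->
  bounded_lipschitz B g -> bounded_lipschitz B (fun y => f y * g y).
Proof.
move=> [M [M0 fM fL]] [N [N0 gN gL]]; have MN0 := mulr_ge0 M0 N0.
exists (M * N + M * N); split=> [|y yB|y z yB zB].
- exact: addr_ge0.
- by rewrite normrM (@le_trans _ _ (M * N)) ?ler_pM ?fM ?gN// lerDl.
- rewrite (_ : _ - _ = f z * (g z - g y) + (f z - f y) * g y); last ring.
  rewrite (le_trans (ler_normD _ _))// !normrM mulrDl lerD//.
    by rewrite -mulrA ler_pM ?fM ?gL.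
  by rewrite mulrAC ler_pM ?gN ?fL.
Qed.

Lemma bounded_lipschitz_poly2 B k c : bounded_lipschitz B (poly2 k c).
Proof.
have lip_sum (I : Type) (s : seq I) (P : pred I) (F : I -> plane -> R) :
    (forall i, bounded_lipschitz B (F i)) ->
    bounded_lipschitz B (fun y => \sum_(i <- s | P i) F i y).
  move=> lipF; elim: s => [|i s IHs].
    by under eq_fun do rewrite big_nil; exact: bounded_lipschitz_cst.
  under eq_fun do rewrite big_cons; case: (P i) => //.
  exact: bounded_lipschitzD.
have lipX f m : bounded_lipschitz B f -> bounded_lipschitz B (fun y => f y ^+ m).
  move=> lipf; elim: m => [|m IHm]; first exact: bounded_lipschitz_cst.
  by under eq_fun do rewrite exprS; exact: bounded_lipschitzM.
have lip1 : bounded_lipschitz B fst.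
  (* [B] bounds the coordinate and 1 is its Lipschitz constant. *)
  exists (Num.max B 1); split=> [|y|y z _ _].
  - by rewrite le_max ler01 orbT.
  - by rewrite prod_normE ge_max => /andP[yB _]; rewrite le_max yB.
  - apply: (@le_trans _ _ `|z - y|); first by rewrite prod_normE le_max lexx.
    by rewrite ler_peMl// le_max lexx orbT.
have lip2 : bounded_lipschitz B snd.
  exists (Num.max B 1); split=> [|y|y z _ _].
  - by rewrite le_max ler01 orbT.
  - by rewrite prod_normE ge_max => /andP[_ yB]; rewrite le_max yB.
  - apply: (@le_trans _ _ `|z - y|); first by rewrite prod_normE le_max lexx orbT.
    by rewrite ler_peMl// le_max lexx orbT.
apply: (lip_sum) => i; apply: (lip_sum) => j.
apply: bounded_lipschitzM; last exact: lipX.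
by apply: bounded_lipschitzM; [exact: bounded_lipschitz_cst|exact: lipX].
Qed.

Lemma measurable_poly2 k c : measurable_fun [set: mplane] (@poly2 R k c).
Proof.
apply: measurable_sum => i; under eq_fun do rewrite big_mkcond.
apply: measurable_sum => j; case: (i + j <= k)%N; last exact: measurable_cst.
apply: measurable_realfun.measurable_funM; last exact: measurable_funX.
by apply: measurable_realfun.measurable_funM => //; exact: measurable_funX.
Qed.

Lemma derivable_poly2 k c (y e : plane) : derivable (@poly2 R k c) y e.
Proof.
have d1 : derivable (fst : plane -> R) y e.
  apply: diff_derivable; apply: (@linear_differentiable R plane R fst).
  by move=> z; exact: cvg_fst.
have d2 : derivable (snd : plane -> R) y e.
  apply: diff_derivable; apply: (@linear_differentiable R plane R snd).
  by move=> z; exact: cvg_snd.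
have dX (f : plane -> R) m : derivable f y e -> derivable (fun z => f z ^+ m) y e.
  move=> df; elim: m => [|m IHm]; first exact: derivable_cst.
  by under eq_fun do rewrite exprS; exact: derivableM.
have dsum (I : Type) (s : seq I) (P : pred I) (F : I -> plane -> R) :
    (forall i, derivable (F i) y e) ->
    derivable (fun z => \sum_(i <- s | P i) F i z) y e.
  move=> dF; elim: s => [|i s IHs].
    by under eq_fun do rewrite big_nil; exact: derivable_cst.
  by under eq_fun do rewrite big_cons; case: (P i) => //; exact: derivableD.
apply: (dsum) => i; apply: (dsum) => j.
apply: derivableM; last exact: dX.
by apply: derivableM; [exact: derivable_cst|exact: dX].
Qed.

End PiecewiseLipschitz.

(** * Piecewise polynomials on the mesh *)

Section PiecewisePolynomials.
Context {R : realType}.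
Local Notation mR := (measurableTypeR R).
Local Notation mplane := (mR * mR)%type.
Local Notation plane := (R * R)%type.
Variables (D : set plane) (n : nat) (x : 'I_n -> plane) (C : {set {set 'I_n}}).
Hypotheses (hD : bounded_domain D) (hmesh : triangulation D x C).
Implicit Types (f g : plane -> R) (e y : plane).
Local Notation Omega := (mesh_interior x C).
Local Notation pw := (cont_pw_poly D x C).

(** Here the equality of [D] with the interior of its closure enters: the open triangles could
    otherwise meet a crack. *)
Lemma mesh_interior_subset : Omega `<=` D.
Proof.
have [_ _ _ _ intD] := hD; rewrite -[X in _ `<=` X]intD (tri_cover hmesh).
by move=> y [K CK]; apply: interiorS => z Kz; exists K.
Qed.

Lemma open_mesh_interior : open Omega.
Proof. by apply: bigcup_open => K _; exact: open_interior. Qed.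

(** A point of [closure D] that is interior to no triangle lies on one of finitely many edges. *)
Lemma ae_mesh_interior : {ae area, forall y, Omega y \/ ~ closure D y}.
Proof.
(* A triangle and one of its vertices name the opposite edge, spanned by the two remaining
   vertices. *)
have : {ae area, forall y (p : {set 'I_n} * 'I_n), p.1 \in C -> p.2 \in p.1 ->
    ~ simplex x (p.1 :\ p.2) y}.
  apply: filter_forall => -[K i] /=; apply: filter_imply => KC.
  apply: filter_imply => iK.
  apply: (@negligibleS _ _ _ (@area R) (simplex x (K :\ i))).
    by move=> y /= /contrapT.
  apply: negligible_edge; first exact: tri_vertex_inj hmesh.
  have := tri_card hmesh KC; rewrite (cardsD1 i) iK => -[].
  by [].
apply: filterS => y nface.
have [|] := pselect (closure D y); last by right.
rewrite (tri_cover hmesh) => -[K /= KC Ky]; left.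
apply: contrapT => nOmega.
have [|i iK] := simplex_face _ _ _ _ (tri_nondegenerate hmesh KC) Ky.
  by move=> Ky'; apply: nOmega; exists K.
exact: (nface (K, i)).
Qed.

(** The plane is covered by finitely many closed triangles, on each of which [f] is a polynomial,
    and the complement of [closure D], on which it vanishes. *)
Lemma pw_measurable k f : pw k f -> measurable_fun [set: mplane] f.
Proof.
move=> [_ f0 fp] _ A mA; rewrite setTI.
have mK K : K \in C -> measurable (simplex x K `&` f @^-1` A : set mplane).
  move=> KC; have [c fc] := fp _ KC.
  have -> : simplex x K `&` f @^-1` A = simplex x K `&` poly2 k c @^-1` A.
    by apply/seteqP; split=> y [Ky /=]; rewrite fc.
  apply: measurableI; first exact: (@closed_measurable_plane R _ (closed_simplex _ _ _)).
  by rewrite -[X in measurable X]setTI; exact: (measurable_poly2 k c).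
have -> : f @^-1` A =
    (\bigcup_(K in [set K | K \in C]) (simplex x K `&` f @^-1` A)) `|`
    (~` closure D `&` f @^-1` A).
  apply/seteqP; split=> y; last by move=> [[K _ []]|[]].
  move=> Ay; have [|nDy] := pselect (closure D y); last by right.
  by rewrite (tri_cover hmesh) => -[K KC Ky]; left; exists K.
apply: measurableU.
  by apply: fin_bigcup_measurable => [|K]; [exact: finite_finset|exact: mK].
have mcD : measurable (~` closure D : set mplane).
  by apply: measurableC; apply: closed_measurable_plane; exact: closed_closure.
have -> : ~` closure D `&` f @^-1` A = ~` closure D `&` [set _ | A 0].
  by apply/seteqP; split=> y [Dy /=]; rewrite f0.
apply: measurableI => //; have [A0|A0] := pselect (A 0).
  by rewrite (_ : [set _ | A 0] = setT)//; apply/seteqP; split.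
by rewrite (_ : [set _ | A 0] = set0)//; apply/seteqP; split.
Qed.

(** Polynomials are Lipschitz on a ball containing the mesh; the sum of the finitely many constants
    serves all triangles at once. *)
Lemma pw_simplex_bound k f : pw k f -> exists M, forall K, K \in C ->
  (forall y, simplex x K y -> `|f y| <= M) /\
  (forall y z, simplex x K y -> simplex x K z -> `|f z - f y| <= M * `|z - y|).
Proof.
move=> [_ _ fp].
have MK K : exists M, 0 <= M /\ (K \in C ->
  (forall y, simplex x K y -> `|f y| <= M) /\
  (forall y z, simplex x K y -> simplex x K z -> `|f z - f y| <= M * `|z - y|)).
  have [KC|KC] := boolP (K \in C); last by exists 0.
  have [c fc] := fp _ KC.
  have [M [M0 fM fL]] := bounded_lipschitz_poly2 (\sum_i `|x i|) k c.
  exists M; split=> // _; split=> [y Ky|y z Ky Kz].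
    by rewrite fc// fM// (norm_simplex _ _ _ _ Ky).
  by rewrite !fc// fL// (norm_simplex _ _ _ _ Ky, norm_simplex _ _ _ _ Kz).
have [M HM] := choice MK.
have leM K : M K <= \sum_L M L.
  by rewrite (bigD1 K)//= lerDl sumr_ge0// => L _; have [] := HM L.
exists (\sum_L M L) => K KC; have [_ /(_ KC)[fM fL]] := HM K.
split=> [y Ky|y z Ky Kz]; first by rewrite (le_trans (fM _ Ky)).
by rewrite (le_trans (fL _ _ Ky Kz))// ler_wpM2r.
Qed.

Lemma closure_bounded y : closure D y -> `|y| <= \sum_i `|x i|.
Proof. by rewrite (tri_cover hmesh) => -[K _]; exact: norm_simplex. Qed.

Lemma integrand_pw k f : pw k f -> integrand f.
Proof.
move=> pwf; split; first exact: pw_measurable _ _ pwf.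
  have [M HM] := pw_simplex_bound _ _ pwf; have [_ f0 _] := pwf.
  exists (Num.max M 0) => y; have [|nDy] := pselect (closure D y).
    rewrite (tri_cover hmesh) => -[K /= /HM[fM _] Ky].
    by rewrite le_max fM.
  by rewrite f0// normr0 le_max lexx orbT.
have [_ f0 _] := pwf; exists (\sum_i `|x i|) => y ltB; apply: f0.
by move=> /(closure_bounded y); rewrite leNgt ltB.
Qed.

Definition zero_boundary f := forall y, (closure D `\` D) y -> f y = 0.

(** Along a line, the parameters are covered by closed pieces: those of the triangles, and those
    outside [D], where the boundary condition makes [f] vanish. The Lipschitz bounds on the pieces
    then chain. *)
Lemma lipschitz_pw k f e : pw k f -> zero_boundary f -> `|e| <= 1 ->
  lipschitz_along e f.
Proof.
move=> pwf f0b e1; have [_ f0 _] := pwf; have [M HM] := pw_simplex_bound _ _ pwf.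
have [Dopen _ _ _ _] := hD.
have f0D y : ~ D y -> f y = 0.
  by move=> nDy; have [cDy|/f0//] := pselect (closure D y); exact: f0b.
exists (Num.max M 0) => y h.
(* [None] indexes the complement of [D]; index sets that are not triangles of the mesh get an empty
   piece. *)
pose F (o : option {set 'I_n}) : set R := if o is Some K then
  (if K \in C then (fun t => y + t *: e) @^-1` simplex x K else set0)
  else (fun t => y + t *: e) @^-1` ~` D.
have cont : continuous (fun t : R => y + t *: e).
  by move=> t; apply: cvgD; [exact: cvg_cst|apply: cvgZl; exact: cvg_id].
have Fcl o : closed (F o).
  case: o => [K|] /=; last first.
    by apply: closed_comp; [move=> t _; exact: cont|exact: open_closedC].
  case: ifP => _; last exact: closed0.
  by apply: closed_comp; [move=> t _; exact: cont|exact: closed_simplex].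
have cover t : exists o, F o t.
  have [Dt|nDt] := pselect (D (y + t *: e)); last by exists None.
  have := subset_closure Dt; rewrite (tri_cover hmesh) => -[K /= KC Kt].
  by exists (Some K) => /=; rewrite KC.
have Flip o s t : F o s -> F o t ->
    `|f (y + t *: e) - f (y + s *: e)| <= Num.max M 0 * `|t - s|.
  case: o => [K|] /=; last first.
    by move=> /f0D -> /f0D ->; rewrite subrr normr0 mulr_ge0// le_max lexx orbT.
  case: ifP => // /HM[_ fL] Ks Kt; rewrite (le_trans (fL _ _ Ks Kt))//.
  have -> : y + t *: e - (y + s *: e) = (t - s) *: e.
    by rewrite opprD addrACA subrr add0r -scalerBl.
  rewrite normrZ (@le_trans _ _ (Num.max M 0 * (`|t - s| * `|e|)))//.
    by rewrite ler_wpM2r ?mulr_ge0// le_max lexx.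
  by rewrite ler_wpM2l ?le_max ?lexx ?orbT// ler_piMr.
have := lipschitz_closed_cover _ F (fun t => f (y + t *: e)) _ Fcl cover Flip 0 h.
by rewrite scale0r addr0 subr0.
Qed.

Lemma derivable_pw k f e y : pw k f -> Omega y -> derivable f y e.
Proof.
move=> [_ _ fp] [K KC Ky]; have [c fc] := fp _ KC.
apply: (@near_eq_derivable _ _ _ (poly2 k c)); last exact: derivable_poly2.
by near=> z; rewrite fc//; near: z; exact: Ky.
Unshelve. all: by end_near. Qed.

Lemma partialE e f y : Omega y -> partial x C e f y = 'D_e f y.
Proof. by move=> Oy; rewrite /partial patchE mem_set. Qed.

Lemma partial0 e f y : ~ Omega y -> partial x C e f y = 0.
Proof. by move=> Oy; rewrite /partial patchE memNset. Qed.

Lemma has_derivative_partial k f e y : pw k f -> Omega y ->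
  has_derivative_along e f y (partial x C e f y).
Proof. by move=> pwf Oy; rewrite partialE//; exact: (derivable_pw _ _ _ _ pwf Oy). Qed.

(** Off [closure D] the function vanishes near [y], so the default value 0 of [partial] is the true
    derivative; only the edges are left out, and they are negligible. *)
Lemma ae_has_derivative_partial k f e : pw k f ->
  {ae area, forall y, has_derivative_along e f y (partial x C e f y)}.
Proof.
move=> pwf; apply: filterS ae_mesh_interior => y [Oy|nDy].
  exact: (has_derivative_partial _ _ _ _ pwf Oy).
have [_ f0 _] := pwf.
rewrite partial0; last by move=> /(@mesh_interior_subset y)/(@subset_closure _ D).
have nearD : \forall z \near y, ~ closure D z.
  by apply: open_nbhs_nbhs; split=> //; apply: closed_openC; exact: closed_closure.
have cont : h *: e + y @[h --> (0 : R)] --> y.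
  have : h *: e + y @[h --> (0 : R)] --> 0 *: e + y.
    by apply: cvgD; [apply: cvgZl; exact: cvg_id|exact: cvg_cst].
  by rewrite scale0r add0r.
have near0 : \forall h \near (0 : R), ~ closure D (h *: e + y) by exact: (cont _ nearD).
apply: cvg_near_cst; rewrite /dnbhs; apply: (@filterS _ (nbhs (0 : R)) _ _ _ _ near0).
by move=> h /f0 /= -> _; rewrite f0// subrr scaler0.
Qed.

(** On the mesh interior [partial] is a limit of difference quotients: it inherits their
    measurability and their bound, a Lipschitz constant of [f]. *)
Lemma integrand_partial k f e : pw k f -> zero_boundary f -> `|e| <= 1 ->
  integrand (partial x C e f).
Proof.
move=> pwf f0b e1; have mOmega : measurable (Omega : set mplane).
  exact: open_measurable_plane open_mesh_interior.
pose t (m : nat) : R := m.+1%:R^-1.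
have t0 m : t m != 0 by rewrite /t invr_eq0 pnatr_eq0.
have t_cvg : t m @[m --> \oo] --> 0 by exact: cvg_harmonic.
have q_cvg y : Omega y -> diff_quotient (t m) e f y @[m --> \oo] --> partial x C e f y.
  by move=> Oy; apply: cvg_quotient => //; exact: has_derivative_partial pwf Oy.
split.
- apply/(measurable_restrictT _ mOmega).
  apply: (@measurable_fun_cvg _ _ _ _ (fun m => diff_quotient (t m) e f)) => [m|y Oy].
    apply: measurable_funS (integrand_measurable _ _) => //.
    exact/integrand_quotient/(integrand_pw _ _ pwf).
  by have := q_cvg y Oy; rewrite partialE.
- have [L fL] := lipschitz_pw _ _ _ pwf f0b e1; exists (Num.max L 0) => y.
  have [Oy|Oy] := pselect (Omega y); last first.
    by rewrite partial0// normr0 le_max lexx orbT.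
  have q_norm : `|diff_quotient (t m) e f y| @[m --> \oo] --> `|partial x C e f y|.
    by apply: cvg_norm; exact: q_cvg.
  rewrite -(cvg_lim (@norm_hausdorff _ R) q_norm); apply: limr_le.
    by apply/cvg_ex; exists `|partial x C e f y|.
  by apply: nearW => m; rewrite le_max (quotient_le _ _ _ _ _ fL).
- exists (\sum_i `|x i|) => y ltB; apply: partial0 => /mesh_interior_subset Dy.
  by have := closure_bounded y (subset_closure Dy); rewrite leNgt ltB.
Qed.

Lemma partial_sum k e y (m : nat) (c : 'I_m -> R) (f : 'I_m -> plane -> R) :
  (forall i, pw k (f i)) ->
  partial x C e (fun z => \sum_i c i * f i z) y = \sum_i c i * partial x C e (f i) y.
Proof.
move=> pwf; have [Oy|Oy] := pselect (Omega y); last first.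
  by rewrite partial0// big1// => i _; rewrite partial0// mulr0.
rewrite partialE// (eq_bigr (fun i => c i *: 'D_e (f i) y)); last first.
  by move=> i _; rewrite partialE.
have -> : (fun z => \sum_i c i * f i z) = \sum_i c i *: f i.
  by apply/funext => z; rewrite fct_sumE.
have df i : derivable (f i) y e by exact: derivable_pw (pwf i) Oy.
rewrite derive_sum; last by move=> i; exact: derivableZ.
by apply: eq_bigr => i _; rewrite deriveZ.
Qed.

End PiecewisePolynomials.

(** * Quadratic forms and Kronecker products *)

Section QuadraticForms.
Context {R : realType}.

Lemma quad_formE {n} (A : 'M[R]_n) v :
  quad_form A v = \sum_i \sum_j v i 0 * v j 0 * A i j.
Proof.
rewrite /quad_form -mulmxA mxE; apply: eq_bigr => i _; rewrite !mxE mulr_sumr.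
by apply: eq_bigr => j _; ring.
Qed.

Definition bilin_form {m n} (q : 'cV[R]_m) (B : 'M[R]_(m, n)) (v : 'cV[R]_n) : R :=
  (q^T *m B *m v) 0 0.

Lemma bilin_formE {m n} q (B : 'M[R]_(m, n)) v :
  bilin_form q B v = \sum_i \sum_j q i 0 * v j 0 * B i j.
Proof.
rewrite /bilin_form -mulmxA mxE; apply: eq_bigr => i _; rewrite !mxE mulr_sumr.
by apply: eq_bigr => j _; ring.
Qed.

Definition spd {n} (S : 'M[R]_n) :=
  S^T = S /\ forall v : 'cV[R]_n, v != 0 -> 0 < quad_form S v.

Lemma quad_form0 {n} (S : 'M[R]_n) : quad_form S 0 = 0.
Proof. by rewrite /quad_form mulmx0 mxE. Qed.

Lemma spd_ge0 {n} (S : 'M[R]_n) v : spd S -> 0 <= quad_form S v.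
Proof.
move=> [_ S0]; have [->|/S0/ltW//] := eqVneq v 0.
by rewrite quad_form0.
Qed.

Lemma spd_unitmx {n} (S : 'M[R]_n) : spd S -> S \in unitmx.
Proof.
move=> [Ssym S0]; rewrite unitmxE unitfE; apply/negP => /det0P[v v0 vS].
have vT0 : v^T != 0 by rewrite trmx_eq0.
by have := S0 _ vT0; rewrite /quad_form trmxK vS mul0mx mxE ltxx.
Qed.

Lemma bilin_form_tr {m n} (q : 'cV[R]_m) (B : 'M[R]_(m, n)) v :
  bilin_form q B v = bilin_form v B^T q.
Proof.
by rewrite /bilin_form -[in RHS](trmxK q) -!trmx_mul mulmxA [RHS]mxE.
Qed.

Lemma quad_form_add {n} (S : 'M[R]_n) (a b : R) u v : S^T = S ->
  quad_form S (a *: u + b *: v) = a ^+ 2 * quad_form S u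
    + 2 * a * b * bilin_form u S v + b ^+ 2 * quad_form S v.
Proof.
move=> Ssym; have := bilin_form_tr v S u; rewrite Ssym /quad_form /bilin_form.
have -> : (a *: u + b *: v)^T = a *: u^T + b *: v^T by rewrite linearD !linearZ.
rewrite !mulmxDl !mulmxDr -!scalemxAl -!scalemxAr.
have entryD (A B : 'M[R]_1) : (A + B) 0 0 = A 0 0 + B 0 0 by rewrite mxE.
have entryZ k (A : 'M[R]_1) : (k *: A) 0 0 = k * A 0 0 by rewrite mxE.
rewrite !(entryD, entryZ) => ->; ring.
Qed.

Lemma bilin_form_sqr_le {n} (S : 'M[R]_n) u v : spd S ->
  bilin_form u S v ^+ 2 <= quad_form S u * quad_form S v.
Proof.
move=> spdS; have [Ssym S0] := spdS; have [->|/S0 Sv] := eqVneq v 0.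
  by rewrite quad_form0 mulr0 /bilin_form mulmx0 mxE expr0n.
(* The form at this combination is [quad_form S v] times the difference of the two sides, and that
   positive factor can be cancelled. *)
have := spd_ge0 _ (quad_form S v *: u + - bilin_form u S v *: v) spdS.
rewrite quad_form_add// => h; rewrite -subr_ge0 -(pmulr_rge0 _ Sv).
by apply: le_trans h _; rewrite le_eqVlt; apply/orP; left; apply/eqP; ring.
Qed.

Definition block_col {Q n} (q : 'cV[R]_(Q * n)) (s : 'I_Q) : 'cV[R]_n :=
  \col_j q (mxtens_index (s, j)) 0.

(** The identity factor annihilates the terms that couple different blocks. *)
Lemma quad_form_tens1mx {Q n} (G : 'M[R]_n) (q : 'cV[R]_(Q * n)) :
  quad_form (1%:M *t G) q = \sum_s quad_form G (block_col q s).
Proof.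
have sum_tens (F : 'I_(Q * n) -> R) :
    \sum_i F i = \sum_(s < Q) \sum_(j < n) F (mxtens_index (s, j)).
  rewrite pair_big /= (reindex (@mxtens_index Q n)) /=; last first.
    exists (@mxtens_unindex Q n) => i _; [exact: mxtens_indexK|exact: mxtens_unindexK].
  by apply: eq_bigr => -[s j] _.
rewrite quad_formE sum_tens; apply: eq_bigr => s _; rewrite quad_formE.
apply: eq_bigr => i _; rewrite sum_tens (bigD1 s)//= [X in _ + X]big1 ?addr0.
  apply: eq_bigr => j _.
  by rewrite tensmxE [1%:M _ _]mxE eqxx mul1r
    [block_col q s i 0]mxE [block_col q s j 0]mxE.
move=> s' s's; rewrite big1// => j _.
by rewrite tensmxE mxE eq_sym (negbTE s's) mul0r mulr0.
Qed.

Lemma block_col_eq0 {Q n} (q : 'cV[R]_(Q * n)) :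
  (forall s, block_col q s = 0) -> q = 0.
Proof.
move=> q0; apply/colP => i; case: (mxtens_indexP i) => s j.
by have /colP/(_ j) := q0 s; rewrite !mxE.
Qed.

Lemma invmx_tens1mx {Q n} (S : 'M[R]_n) : S \in unitmx ->
  invmx (1%:M *t S : 'M[R]_(Q * n)) = 1%:M *t invmx S.
Proof.
move=> Su; have E : (1%:M *t S : 'M[R]_(Q * n)) *m (1%:M *t invmx S) = 1%:M.
  rewrite tensmx_mul mulmx1 mulmxV//; apply/matrixP => i j.
  case: (mxtens_indexP i) => s k; case: (mxtens_indexP j) => s' k'.
  by rewrite tensmxE !mxE (can_eq (@mxtens_indexK _ _)) xpair_eqE -natrM mulnb.
have [U _] := mulmx1_unit E.
by rewrite -[RHS](mulKmx U) E mulmx1.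
Qed.

End QuadraticForms.

(** * Schur complements *)

Section SchurComplement.
Context {R : realType}.

(** Division by zero gives 0, so a positive lower bound on the quotient forces [b] to be nonzero,
    and then positive as [a] is not negative. This yields the positivity of the multigrid form and
    of the diagonal mass form. *)
Lemma ratio_bounds (a b l u : R) : 0 < l -> 0 <= a -> l <= a / b <= u ->
  [/\ 0 < b, l * b <= a & a <= u * b].
Proof.
move=> l0 a0 /andP[lab abu]; have ab0 : 0 < a / b by exact: lt_le_trans lab.
have b0 : 0 < b.
  rewrite -invr_gt0 ltNge; apply/negP => b0.
  by have := le_lt_trans (mulr_ge0_le0 a0 b0) ab0; rewrite ltxx.
by split=> //; [rewrite -ler_pdivlMr|rewrite -ler_pdivrMr].
Qed.

Variables (m n : nat) (A S : 'M[R]_n) (B : 'M[R]_(m, n)).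
Hypothesis S_spd : spd S.

(** The representer of [bilin_form q B] in the inner product of [S]; its energy is the Schur form,
    so the estimates can do without the inverse matrix. *)
Let w (q : 'cV[R]_m) : 'cV[R]_n := invmx S *m (B^T *m q).

Let Sw q : S *m w q = B^T *m q.
Proof. by rewrite /w mulKVmx// spd_unitmx. Qed.

Let bilin_formw q c : bilin_form q B c = bilin_form (w q) S c.
Proof.
have [Ssym _] := S_spd; rewrite bilin_form_tr [RHS]bilin_form_tr Ssym.
by rewrite /bilin_form -!mulmxA Sw.
Qed.

Let schur_formw q : quad_form (B *m invmx S *m B^T) q = quad_form S (w q).
Proof.
rewrite -[RHS]/(bilin_form (w q) S (w q)) -bilin_formw.
by rewrite /quad_form /bilin_form /w !mulmxA.
Qed.

(* The saddle form is evaluated at [c = - w / Delta], where [w] solves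
   [S w = B^T q]. *)
Lemma schur_form_le (Delta mq : R) q : 0 < Delta ->
  (forall v, quad_form A v <= Delta * quad_form S v) ->
  (forall c, 0 <= mq + 2 * bilin_form q B c + quad_form A c) ->
  quad_form (B *m invmx S *m B^T) q <= Delta * mq.
Proof.
move=> Delta0 AS saddle; rewrite schur_formw.
set s := quad_form S (w q); have := saddle (- Delta^-1 *: w q).
have -> : bilin_form q B (- Delta^-1 *: w q) = - Delta^-1 * s.
  by rewrite bilin_formw /bilin_form -scalemxAr mxE.
have -> : quad_form A (- Delta^-1 *: w q) = Delta^-1 ^+ 2 * quad_form A (w q).
  have wT : (- Delta^-1 *: w q)^T = - Delta^-1 *: (w q)^T by rewrite linearZ.
  by rewrite /quad_form wT -scalemxAr -!scalemxAl scalerA mxE mulrNN expr2.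
(* The linear term contributes [- 2 * Delta^-1 * s], of which the quadratic term takes back at most
   half. *)
have : Delta^-1 ^+ 2 * quad_form A (w q) <= Delta^-1 * s.
  apply: le_trans (ler_wpM2l _ (AS _)) _; first exact: sqr_ge0.
  by rewrite mulrA expr2 mulfVK ?gt_eqF.
move=> h1 h2; rewrite -ler_pdivrMl//.
have : 0 <= mq - Delta^-1 * s by lra.
by rewrite subr_ge0.
Qed.

(** Cauchy-Schwarz for [S], applied to [w q] and [c]. *)
Lemma bilin_form_schur_le q c : bilin_form q B c ^+ 2 <=
  quad_form (B *m invmx S *m B^T) q * quad_form S c.
Proof. by rewrite bilin_formw schur_formw bilin_form_sqr_le. Qed.

Lemma schur_form_ge0 q : 0 <= quad_form (B *m invmx S *m B^T) q.
Proof. by rewrite schur_formw spd_ge0. Qed.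

End SchurComplement.

(** * Finite element matrices as integrals *)

Section FiniteElementForms.
Context {R : realType}.
Local Notation mR := (measurableTypeR R).
Local Notation mplane := (mR * mR)%type.
Local Notation plane := (R * R)%type.
Variables (D : set plane) (Np : nat) (x : 'I_Np -> plane) (C : {set {set 'I_Np}}).
Variables (Nu : nat) (phi : 'I_Nu -> plane -> plane) (psi : 'I_Np -> plane -> R).
Hypotheses (hD : bounded_domain D) (hmesh : triangulation D x C).
Hypotheses (hphi : forall i, V0h D x C (phi i)) (hpsi : forall j, Wh D x C (psi j)).
Implicit Types (c d : 'cV[R]_Nu) (q : 'cV[R]_Np) (y : plane).

Lemma measurable_domain : measurable (D : set mplane).
Proof. by apply: open_measurable_plane; have [] := hD. Qed.

Lemma Rintegral_sum (m : nat) (a : 'I_m -> R) (f : 'I_m -> plane -> R) :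
  (forall i, integrand (f i)) ->
  \int[area]_(y in D) (\sum_i a i * f i y) = \sum_i a i * \int[area]_(y in D) f i y.
Proof.
move=> intf.
have mD := measurable_domain.
suff H (s : seq 'I_m) : \int[area]_(y in D) (\sum_(i <- s) a i * f i y) =
    \sum_(i <- s) a i * \int[area]_(y in D) f i y by exact: H.
elim: s => [|i s IHs].
  rewrite big_nil; under eq_Rintegral do rewrite big_nil.
  by rewrite Rintegral_cst// mul0r.
rewrite big_cons -IHs -RintegralZl//; last exact: integrand_integrable.
rewrite -RintegralD//; first last.
- by apply: integrand_integrable => //; apply: integrand_sum => j; exact: integrandZ.
- by apply: integrand_integrable => //; exact: integrandZ.
by apply: eq_Rintegral => y _; rewrite big_cons.
Qed.

Lemma Rintegral_domain (f : plane -> R) : (forall y, ~ D y -> f y = 0) ->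
  \int[area]_(y in D) f y = \int[area]_y f y.
Proof.
move=> f0; rewrite Rintegral_mkcond; congr (Rintegral _ _ _); apply/funext => y.
by rewrite patchE; case: ifPn => //; rewrite notin_setE => /f0.
Qed.

Definition velocity c y : plane := \sum_i c i 0 *: phi i y.
Definition pressure q y : R := \sum_j q j 0 * psi j y.

Lemma velocity_fst c : fst \o velocity c = fun y => \sum_i c i 0 * (fst \o phi i) y.
Proof.
apply/funext => y; rewrite /velocity /=.
by rewrite (big_morph (fun z : plane => z.1) (id1 := 0) (op1 := +%R)).
Qed.

Lemma velocity_snd c : snd \o velocity c = fun y => \sum_i c i 0 * (snd \o phi i) y.
Proof.
apply/funext => y; rewrite /velocity /=.
by rewrite (big_morph (fun z : plane => z.2) (id1 := 0) (op1 := +%R)).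
Qed.

Let e1 : plane := (1, 0).
Let e2 : plane := (0, 1).

Let norm_e1 : `|e1| <= 1.
Proof. by rewrite prod_normE /= normr1 normr0 ge_max lexx ler01. Qed.

Let norm_e2 : `|e2| <= 1.
Proof. by rewrite prod_normE /= normr1 normr0 ge_max lexx ler01. Qed.

Let pw1 i : cont_pw_poly D x C 2 (fst \o phi i).
Proof. by have [] := hphi i. Qed.

Let pw2 i : cont_pw_poly D x C 2 (snd \o phi i).
Proof. by have [] := hphi i. Qed.

Let zero1 i : zero_boundary D (fst \o phi i).
Proof. by move=> y Dy; have [_ _ /(_ y Dy)] := hphi i => /= ->. Qed.

Let zero2 i : zero_boundary D (snd \o phi i).
Proof. by move=> y Dy; have [_ _ /(_ y Dy)] := hphi i => /= ->. Qed.

Lemma partial_velocity_fst e c y : partial x C e (fst \o velocity c) y =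
  \sum_i c i 0 * partial x C e (fst \o phi i) y.
Proof. by rewrite velocity_fst; exact: partial_sum pw1. Qed.

Lemma partial_velocity_snd e c y : partial x C e (snd \o velocity c) y =
  \sum_i c i 0 * partial x C e (snd \o phi i) y.
Proof. by rewrite velocity_snd; exact: partial_sum pw2. Qed.

Let intp1 e i : `|e| <= 1 -> integrand (partial x C e (fst \o phi i)).
Proof.
by move=> ?; exact: (integrand_partial _ _ _ _ hD hmesh _ _ _ (pw1 i) (zero1 i)).
Qed.

Let intp2 e i : `|e| <= 1 -> integrand (partial x C e (snd \o phi i)).
Proof.
by move=> ?; exact: (integrand_partial _ _ _ _ hD hmesh _ _ _ (pw2 i) (zero2 i)).
Qed.

Lemma integrand_psi j : integrand (psi j).
Proof. exact: (integrand_pw _ _ _ _ hmesh _ _ (hpsi j)). Qed.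

Lemma integrand_grad_dot i j : integrand (grad_dot x C (phi i) (phi j)).
Proof.
apply: integrandD; last by apply: integrandM; exact: intp2.
apply: integrandD; last by apply: integrandM; exact: intp2.
by apply: integrandD; apply: integrandM; exact: intp1.
Qed.

Lemma integrand_divergence i : integrand (divergence x C (phi i)).
Proof. by apply: integrandD; [exact: intp1|exact: intp2]. Qed.

Lemma integrand_div_velocity c : integrand (divergence x C (velocity c)).
Proof.
apply: integrandD.
  rewrite /dx (funext (partial_velocity_fst (1, 0) c)).
  by apply: integrand_sum => i; apply: integrandZ; exact: intp1.
rewrite /dy (funext (partial_velocity_snd (0, 1) c)).
by apply: integrand_sum => i; apply: integrandZ; exact: intp2.
Qed.

Lemma integrand_pressure q : integrand (pressure q).
Proof. by apply: integrand_sum => i; apply: integrandZ; exact: integrand_psi. Qed.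

Let mul_sums (m p : nat) (a f : 'I_m -> R) (b g : 'I_p -> R) :
  (\sum_i a i * f i) * (\sum_j b j * g j) = \sum_i a i * (\sum_j b j * (f i * g j)).
Proof.
rewrite mulr_suml; apply: eq_bigr => i _; rewrite -mulrA mulr_sumr; congr (_ * _).
by apply: eq_bigr => j _; rewrite mulrCA.
Qed.

Let Rintegral_mul_sums (m p : nat) (a : 'I_m -> R) (b : 'I_p -> R)
    (f : 'I_m -> plane -> R) (g : 'I_p -> plane -> R) :
  (forall i, integrand (f i)) -> (forall j, integrand (g j)) ->
  \int[area]_(y in D) ((\sum_i a i * f i y) * (\sum_j b j * g j y)) =
  \sum_i \sum_j a i * b j * \int[area]_(y in D) (f i y * g j y).
Proof.
move=> intf intg; under eq_Rintegral do rewrite mul_sums.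
rewrite (Rintegral_sum _ _ (fun i y => \sum_j b j * (f i y * g j y))); last first.
  move=> i; apply: integrand_sum => j; apply: integrandZ; exact: integrandM.
apply: eq_bigr => i _; rewrite (Rintegral_sum _ _ (fun j y => f i y * g j y)); last first.
  by move=> j; exact: integrandM.
by rewrite mulr_sumr; apply: eq_bigr => j _; rewrite mulrA.
Qed.

Lemma quad_form_stiffness c : quad_form (stiffness D x C phi) c =
  \int[area]_(y in D) grad_dot x C (velocity c) (velocity c) y.
Proof.
rewrite quad_formE; transitivity (\int[area]_(y in D)
    \sum_i c i 0 * \sum_j c j 0 * grad_dot x C (phi i) (phi j) y).
  rewrite (Rintegral_sum _ _ (fun i y => \sum_j c j 0 * grad_dot x C (phi i) (phi j) y)).
    apply: eq_bigr => i _; rewrite Rintegral_sum; last exact: integrand_grad_dot.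
    by rewrite mulr_sumr; apply: eq_bigr => j _; rewrite mxE mulrA.
  by move=> i; apply: integrand_sum => j; apply: integrandZ; exact: integrand_grad_dot.
apply: eq_Rintegral => y _; rewrite /grad_dot /dx /dy.
rewrite !partial_velocity_fst !partial_velocity_snd !mul_sums -!big_split /=.
apply: eq_bigr => i _; rewrite -!mulrDr -!big_split /=; congr (_ * _).
by apply: eq_bigr => j _; rewrite !mulrDr.
Qed.

Lemma quad_form_mass q :
  quad_form (mass_matrix D psi) q = \int[area]_(y in D) (pressure q y ^+ 2).
Proof.
rewrite quad_formE; under eq_Rintegral do rewrite expr2.
rewrite Rintegral_mul_sums; [|exact: integrand_psi|exact: integrand_psi].
by apply: eq_bigr => i _; apply: eq_bigr => j _; rewrite mxE.
Qed.

Lemma bilin_form_div_matrix q c : bilin_form q (div_matrix D x C phi psi) c =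
  - \int[area]_(y in D) (pressure q y * divergence x C (velocity c) y).
Proof.
have divE y : divergence x C (velocity c) y = \sum_i c i 0 * divergence x C (phi i) y.
  rewrite /divergence /dx /dy partial_velocity_fst partial_velocity_snd -big_split /=.
  by apply: eq_bigr => i _; rewrite mulrDr.
under eq_Rintegral do rewrite divE.
rewrite Rintegral_mul_sums; [|exact: integrand_psi|exact: integrand_divergence].
rewrite bilin_formE -sumrN; apply: eq_bigr => i _.
by rewrite -sumrN; apply: eq_bigr => j _; rewrite mxE mulrN.
Qed.

(** The derivatives are zero outside [D], so both integrals extend to the plane, where translations
    are available. *)
Let mixed_derivatives_basis i j :
  \int[area]_(y in D)
    (partial x C e1 (fst \o phi i) y * partial x C e2 (snd \o phi j) y) =
  \int[area]_(y in D) (partial x C e2 (fst \o phi i) y * partial x C e1 (snd \o phi j) y).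
Proof.
have toplane e f :
    \int[area]_(y in D)
      (partial x C e (fst \o phi i) y * partial x C f (snd \o phi j) y) =
    \int[area]_y (partial x C e (fst \o phi i) y * partial x C f (snd \o phi j) y).
  apply: Rintegral_domain => y nDy; rewrite partial0 ?mul0r//.
  by move=> /(mesh_interior_subset _ _ _ _ hD hmesh).
rewrite (toplane e1 e2) (toplane e2 e1).
have u_pw := pw1 i; have w_pw := pw2 j.
have u0 := zero1 i; have w0 := zero2 j.
exact: (mixed_derivatives_swap _ _ _ _ _ _
  (integrand_pw _ _ _ _ hmesh _ _ u_pw) (integrand_pw _ _ _ _ hmesh _ _ w_pw)
  (intp1 _ i norm_e1) (intp1 _ i norm_e2) (intp2 _ j norm_e1) (intp2 _ j norm_e2)
  (lipschitz_pw _ _ _ _ hD hmesh _ _ _ u_pw u0 norm_e1)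
  (lipschitz_pw _ _ _ _ hD hmesh _ _ _ u_pw u0 norm_e2)
  (lipschitz_pw _ _ _ _ hD hmesh _ _ _ w_pw w0 norm_e1)
  (lipschitz_pw _ _ _ _ hD hmesh _ _ _ w_pw w0 norm_e2)
  (ae_has_derivative_partial _ _ _ _ hD hmesh _ _ _ u_pw)
  (ae_has_derivative_partial _ _ _ _ hD hmesh _ _ _ u_pw)
  (ae_has_derivative_partial _ _ _ _ hD hmesh _ _ _ w_pw)
  (ae_has_derivative_partial _ _ _ _ hD hmesh _ _ _ w_pw)).
Qed.

(** Expanding both components in the basis reduces the identity to pairs of basis functions. *)
Lemma mixed_derivatives_velocity c :
  \int[area]_(y in D) (dx x C (fst \o velocity c) y * dy x C (snd \o velocity c) y) =
  \int[area]_(y in D) (dy x C (fst \o velocity c) y * dx x C (snd \o velocity c) y).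
Proof.
have expand e f : `|e| <= 1 -> `|f| <= 1 -> \int[area]_(y in D)
    (partial x C e (fst \o velocity c) y * partial x C f (snd \o velocity c) y) =
    \sum_i \sum_j c i 0 * c j 0 * \int[area]_(y in D)
      (partial x C e (fst \o phi i) y * partial x C f (snd \o phi j) y).
  move=> le_e le_f.
  rewrite -(Rintegral_mul_sums _ _ _ _ (fun i => partial x C e (fst \o phi i))
    (fun j => partial x C f (snd \o phi j))
    (fun i => intp1 e i le_e) (fun j => intp2 f j le_f)).
  apply: eq_Rintegral => y _.
  by rewrite (partial_velocity_fst e) (partial_velocity_snd f).
rewrite /dx /dy (expand _ _ norm_e1 norm_e2) (expand _ _ norm_e2 norm_e1).
by apply: eq_bigr => i _; apply: eq_bigr => j _; rewrite mixed_derivatives_basis.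
Qed.

Let integrand_partial_velocity_fst e c :
  `|e| <= 1 -> integrand (partial x C e (fst \o velocity c)).
Proof.
move=> ?; rewrite (funext (partial_velocity_fst e c)).
by apply: integrand_sum => i; apply: integrandZ; exact: intp1.
Qed.

Let integrand_partial_velocity_snd e c :
  `|e| <= 1 -> integrand (partial x C e (snd \o velocity c)).
Proof.
move=> ?; rewrite (funext (partial_velocity_snd e c)).
by apply: integrand_sum => i; apply: integrandZ; exact: intp2.
Qed.

Lemma quad_form_stiffness_ge0 c : 0 <= quad_form (stiffness D x C phi) c.
Proof.
rewrite quad_form_stiffness; apply: Rintegral_ge0 => y _; rewrite /grad_dot.
by rewrite !addr_ge0// -expr2 sqr_ge0.
Qed.

Lemma quad_form_mass_ge0 q : 0 <= quad_form (mass_matrix D psi) q.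
Proof. by rewrite quad_form_mass; apply: Rintegral_ge0 => y _; exact: sqr_ge0. Qed.

Let div_sqr_le (ux uy wx wy : plane -> R) :
  integrand ux -> integrand uy -> integrand wx -> integrand wy ->
  \int[area]_(y in D) (ux y * wy y) = \int[area]_(y in D) (uy y * wx y) ->
  \int[area]_(y in D) ((ux y + wy y) ^+ 2) <= \int[area]_(y in D)
    (ux y * ux y + uy y * uy y + wx y * wx y + wy y * wy y).
Proof.
move=> iux iuy iwx iwy swap; have mD := measurable_domain.
have idiv := integrandD _ _ iux iwy.
have idiv2 : integrand (fun y => (ux y + wy y) ^+ 2).
  by under eq_fun do rewrite expr2; exact: integrandM.
have iuw1 := integrandM _ _ iuy iwx; have iuw2 := integrandM _ _ iux iwy.
have iuw := integrandB _ _ iuw1 iuw2; have icross := integrandZ 2 _ iuw.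
(* A null integral is added, after which the difference of the two integrands is
   [(uy y - wx y) ^+ 2], the square of the scalar curl. *)
have -> : \int[area]_(y in D) ((ux y + wy y) ^+ 2) =
    \int[area]_(y in D) ((ux y + wy y) ^+ 2 + 2 * (uy y * wx y - ux y * wy y)).
  rewrite RintegralD//; do ?exact: integrand_integrable.
  rewrite RintegralZl//; last exact: integrand_integrable.
  rewrite RintegralB//; do ?exact: integrand_integrable.
  by rewrite swap subrr mulr0 addr0.
apply: le_Rintegral => //.
- by apply: (integrand_integrable _ _ mD); exact: integrandD.
- apply: (integrand_integrable _ _ mD); apply: integrandD; last exact: integrandM.
  by apply: integrandD; last exact: integrandM; apply: integrandD; exact: integrandM.
- move=> y _; rewrite -subr_ge0.
  rewrite [X in 0 <= X](_ : _ = (uy y - wx y) ^+ 2) ?sqr_ge0//; ring.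
Qed.

Lemma divergence_le_gradient c :
  \int[area]_(y in D) (divergence x C (velocity c) y ^+ 2) <=
  \int[area]_(y in D) grad_dot x C (velocity c) (velocity c) y.
Proof.
exact: (div_sqr_le _ _ _ _ (integrand_partial_velocity_fst _ c norm_e1)
  (integrand_partial_velocity_fst _ c norm_e2)
  (integrand_partial_velocity_snd _ c norm_e1)
  (integrand_partial_velocity_snd _ c norm_e2) (mixed_derivatives_velocity c)).
Qed.

Let Rintegral_sqrB (p d : plane -> R) : integrand p -> integrand d ->
  \int[area]_(y in D) ((p y - d y) ^+ 2) = \int[area]_(y in D) (p y ^+ 2) +
    2 * - (\int[area]_(y in D) (p y * d y)) + \int[area]_(y in D) (d y ^+ 2).
Proof.
move=> ip id; have mD := measurable_domain.
have ipp : integrand (fun y => p y ^+ 2) by exact: integrandM.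
have idd : integrand (fun y => d y ^+ 2) by exact: integrandM.
have ipd := integrandM _ _ ip id; have i2 := integrandZ (- 2) _ ipd.
have i12 := integrandD _ _ ipp i2.
transitivity (\int[area]_(y in D) (p y ^+ 2 + - 2 * (p y * d y) + d y ^+ 2)).
  by apply: eq_Rintegral => y _; ring.
rewrite RintegralD//; do ?exact: integrand_integrable.
rewrite RintegralD//; do ?exact: integrand_integrable.
rewrite RintegralZl//; last exact: integrand_integrable.
by rewrite mulrN mulNr.
Qed.

(** Completing the square: once the gradient term is bounded below by the divergence term, what
    remains is the integral of the square of pressure minus divergence. *)
Lemma saddle_form_ge0 q c : 0 <= quad_form (mass_matrix D psi) q +
  2 * bilin_form q (div_matrix D x C phi psi) c + quad_form (stiffness D x C phi) c.
Proof.
rewrite quad_form_mass bilin_form_div_matrix quad_form_stiffness.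
apply: le_trans (_ : _ <= \int[area]_(y in D) (pressure q y ^+ 2) +
  2 * - (\int[area]_(y in D) (pressure q y * divergence x C (velocity c) y)) +
  \int[area]_(y in D) (divergence x C (velocity c) y ^+ 2)) _.
  rewrite -(Rintegral_sqrB _ _ (integrand_pressure q) (integrand_div_velocity c)).
  by apply: Rintegral_ge0 => y _; exact: sqr_ge0.
by rewrite lerD2l divergence_le_gradient.
Qed.

End FiniteElementForms.

(** * Spectral bounds for the preconditioned Schur complement *)

Arguments velocity {R Nu}.
Arguments pressure {R Np}.

Theorem lemma7p3 (R : realType) (D : set (R * R))
    (Np : nat) (x : 'I_Np -> R * R) (C : {set {set 'I_Np}})
    (Nu : nat) (phi : 'I_Nu -> R * R -> R * R) (psi : 'I_Np -> R * R -> R)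
    (Amg : 'M[R]_Nu) (delta Delta gamma theta Theta : R) (M k : nat)
    (hD : bounded_domain D)
    (hmesh : triangulation D x C)
    (hphi : velocity_basis D x C phi)
    (hpsi : nodal_basis D x C psi)
    (hdelta : 0 < delta) (hDelta : 0 < Delta)
    (hAmg_sym : Amg^T = Amg)
    (hAmg : forall v : 'cV[R]_Nu, v != 0 ->
       delta <= quad_form (stiffness D x C phi) v / quad_form Amg v <= Delta)
    (hgamma : 0 < gamma)
    (hinfsup : gamma%:E = inf_sup_constant D x C)
    (htheta : 0 < theta) (hTheta : 0 < Theta)
    (hmass : forall q : 'cV[R]_Np, q != 0 ->
       theta ^+ 2 <= quad_form (mass_matrix D psi) q /
                     quad_form (diag_part (mass_matrix D psi)) q
                  <= Theta ^+ 2) :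
  let Q := 'C(M + k, k) in
  let AAmg : 'M[R]_(Q * Nu) := 1%:M *t Amg in
  let BB : 'M[R]_(Q * Np, Q * Nu) := 1%:M *t div_matrix D x C phi psi in
  let Sp : 'M[R]_(Q * Np) := 1%:M *t diag_part (mass_matrix D psi) in
  let ratio (q : 'cV[R]_(Q * Np)) :=
    quad_form (BB *m invmx AAmg *m BB^T) q / quad_form Sp q in
  (forall q : 'cV[R]_(Q * Np), q != 0 -> zero_mean_pressure D x C psi q ->
     delta * theta ^+ 2 * gamma ^+ 2 <= ratio q <= Delta * Theta ^+ 2) /\
  (forall q : 'cV[R]_(Q * Np), q != 0 -> ratio q <= Delta * Theta ^+ 2).
Proof.
move=> Q AAmg BB Sp ratio.
have [phiV phi_span] := hphi; have [psiW psi_nodal] := hpsi.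
pose A := stiffness D x C phi; pose B := div_matrix D x C phi psi.
pose Mp := mass_matrix D psi; pose Dp := diag_part Mp.
pose schur := quad_form (B *m invmx Amg *m B^T).
have A_ge0 c : 0 <= quad_form A c.
  by exact: (quad_form_stiffness_ge0 _ _ _ _ _ _ hD hmesh phiV).
have Mp_ge0 q : 0 <= quad_form Mp q.
  by exact: (quad_form_mass_ge0 _ _ _ _ _ hD hmesh psiW).
have AmgP v : v != 0 -> [/\ 0 < quad_form Amg v,
    delta * quad_form Amg v <= quad_form A v & quad_form A v <= Delta * quad_form Amg v].
  by move=> v0; apply: ratio_bounds => //; exact: hAmg.
have DpP q : q != 0 -> [/\ 0 < quad_form Dp q,
    theta ^+ 2 * quad_form Dp q <= quad_form Mp q &
    quad_form Mp q <= Theta ^+ 2 * quad_form Dp q].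
  by move=> q0; apply: ratio_bounds; [exact: exprn_gt0| |exact: hmass].
have Amg_spd : spd Amg by split=> // v /AmgP[].
(* Upper bound on one block; zero is treated apart, as the hypotheses on quotients say nothing about
   it. *)
have schur_le q : schur q <= Delta * Theta ^+ 2 * quad_form Dp q.
  have [->|q0] := eqVneq q 0; first by rewrite /schur !quad_form0 mulr0.
  have [_ _ MpD] := DpP _ q0; rewrite -mulrA.
  apply: le_trans (ler_wpM2l (ltW hDelta) MpD).
  apply: (schur_form_le _ _ A _ _ Amg_spd) => // [v|c].
    by have [->|/AmgP[]//] := eqVneq v 0; rewrite !quad_form0 mulr0.
  exact: (saddle_form_ge0 _ _ _ _ _ _ _ hD hmesh phiV psiW).
(* Values at the vertices recover the coefficients, so a nonzero [q] gives a nonzero pressure, as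
   the infimum requires. *)
have pressure_inj q : pressure psi q = (fun=> 0) -> q = 0.
  move=> q0; apply/colP => j; rewrite mxE -[RHS](congr1 (@^~ (x j)) q0) /pressure.
  rewrite (bigD1 j)//= psi_nodal eqxx mulr1 big1 ?addr0// => i ij.
  by rewrite psi_nodal (negbTE ij) mulr0.
have schur_ge q : W0h D x C (pressure psi q) ->
    delta * theta ^+ 2 * gamma ^+ 2 * quad_form Dp q <= schur q.
  have [->|q0] := eqVneq q 0; first by rewrite /schur !quad_form0 mulr0.
  move=> W0q; have [Dq0 DqM _] := DpP _ q0.
  have Mq0 : 0 < quad_form Mp q by apply: lt_le_trans DqM; rewrite mulr_gt0// exprn_gt0.
  have dM0 : 0 < delta * quad_form Mp q by exact: mulr_gt0.
  have schur0 : 0 <= schur q by exact: schur_form_ge0.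
  (* [T] will bound every inf-sup quotient of this pressure, hence their supremum and, a fortiori,
     the infimum [gamma]. *)
  pose T := Num.sqrt (schur q / (delta * quad_form Mp q)).
  suff gammaT : gamma <= T.
    have : gamma ^+ 2 <= schur q / (delta * quad_form Mp q).
      rewrite -[leRHS]sqr_sqrtr ?divr_ge0 ?(ltW dM0)//.
      by rewrite lerXn2r// nnegrE ?sqrtr_ge0// ltW.
    rewrite ler_pdivlMr//; apply: le_trans.
    rewrite [leLHS](_ : _ =
      delta * gamma ^+ 2 * (theta ^+ 2 * quad_form Dp q)); last ring.
    rewrite [leRHS](_ : _ = delta * gamma ^+ 2 * quad_form Mp q); last ring.
    by rewrite ler_wpM2l// mulr_ge0 ?sqr_ge0// ltW.
  rewrite -lee_fin hinfsup; apply: le_trans (_ : (_ <= ereal_sup _)%E) _.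
    apply: ereal_inf_lbound; exists (pressure psi q); split=> //.
    by move=> /pressure_inj q0'; rewrite q0' eqxx in q0.
  (* Each competitor [v] is expanded in the basis, which turns norms and integrals into forms; its
     coefficients are not all zero, so the forms of [Amg] and [A] are positive there. *)
  apply: ge_ereal_sup => _ [v [/phi_span[c [vc _]] v0 ->]].
  pose c' := \col_i c i.
  have {}vc : v = velocity phi c'.
    by rewrite vc; apply/funext => y; apply: eq_bigr => i _; rewrite mxE.
  have c0 : c' != 0.
    apply: contra_not_neq v0 => c0; rewrite vc c0; apply/funext => y.
    by rewrite /velocity big1// => i _; rewrite mxE scale0r.
  have [S0 SA _] := AmgP _ c0.
  rewrite lee_fin vc /grad_L2norm /L2norm.
  rewrite -(quad_form_stiffness _ _ _ _ _ _ hD hmesh phiV).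
  rewrite -(quad_form_mass _ _ _ _ _ hD hmesh psiW) -/A -/Mp.
  (* The absolute value absorbs the minus sign of [div_matrix]. *)
  rewrite -normrN -(bilin_form_div_matrix _ _ _ _ _ _ _ hD hmesh phiV psiW) -/B.
  have A0 : 0 < quad_form A c' by apply: lt_le_trans SA; exact: mulr_gt0.
  rewrite -(sqrtrM _ (ltW A0)) -sqrtr_sqr.
  rewrite -(sqrtrV (ltW (mulr_gt0 A0 Mq0))) -(sqrtrM _ (sqr_ge0 _)); apply: ler_wsqrtr.
  rewrite ler_pdivrMr ?mulr_gt0//.
  have := bilin_form_schur_le _ _ _ B Amg_spd q c'; rewrite -/(schur q) => bs.
  apply: (le_trans bs).
  (* What remains is [quad_form Amg c' <= quad_form A c' / delta], the lower half of the spectral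
     equivalence. *)
  rewrite [leRHS](_ : _ = schur q * (quad_form A c' / delta)); last first.
    by field; rewrite !gt_eqF.
  by rewrite ler_wpM2l// ler_pdivlMr// mulrC.
have numE q : quad_form (BB *m invmx AAmg *m BB^T) q = \sum_s schur (block_col q s).
  rewrite /AAmg invmx_tens1mx ?spd_unitmx// /BB trmx_tens trmx1 !tensmx_mul !mulmx1.
  exact: quad_form_tens1mx.
have denE q : quad_form Sp q = \sum_s quad_form Dp (block_col q s).
  exact: quad_form_tens1mx.
have Dp_ge0 q : 0 <= quad_form Dp q.
  by have [->|/DpP[/ltW]] := eqVneq q 0; rewrite ?quad_form0.
have den_gt0 q : q != 0 -> 0 < quad_form Sp q.
  move=> q0; rewrite denE lt_neqAle sumr_ge0// andbT eq_sym.
  apply: contra_neq q0 => /eqP; rewrite psumr_eq0// => /allP den0.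
  apply: block_col_eq0 => s; apply/eqP; apply: contraTT (den0 s (mem_index_enum s)).
  by move=> /DpP[]; rewrite lt_neqAle eq_sym => /andP[].
have ratio_le q : q != 0 -> ratio q <= Delta * Theta ^+ 2.
  move=> q0; rewrite /ratio ler_pdivrMr ?den_gt0// numE denE mulr_sumr.
  by apply: ler_sum => s _; exact: schur_le.
(* The lower bound is applied to every block, each being a zero-mean pressure. *)
split=> // q q0 W0q; rewrite ratio_le// andbT /ratio ler_pdivlMr ?den_gt0//.
rewrite numE denE mulr_sumr; apply: ler_sum => s _; apply: schur_ge.
have -> : pressure psi (block_col q s) =
    fun y => \sum_(j < Np) q (mxtens_index (s, j)) 0 * psi j y.
  by apply/funext => y; apply: eq_bigr => j _; rewrite mxE.
exact: W0q.
Qed.
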